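(* Let $E$ be the linear space of (Lebesgue, absolutely) integrable functions on $[0,1]$ (modulo equality almost everywhere), with the norm $\Vert f\Vert=\int_{0}^{1}\vert f(t)\vert\,dt$, the convolution multiplication $(f\times g)(x)=\int_{0}^{x}f(x-t)g(t)\,dt$, and the natural involution $f^{\ast}(x)=\overline{f(x)}$. Then $(E,\Vert\cdot\Vert)$ is a symmetric radical commutative Banach *-algebra. Let $A=E\oplus\mathbb{C}e$ be the algebra obtained from $E$ by adjunction of an identity $e$. Then $A$ is a commutative Banach *-algebra with identity, $A$ is symmetric, and $R(A)=E$; thus $A$ is not semisimple. Hence $A'$ is not included in $\mathrm{span}_{A^{\ast}}P(A)$. So $A$ is a BP*-algebra whose topological dual is not included in the linear span of its positive linear functionals, which answers negatively the question of M. A. Hennings whether the positive linear functionals on a BP*-algebra span its topological dual.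
   Context: $A=E\oplus\mathbb{C}e$ carries the usual unitization structure: involution $(f+\lambda e)^{\ast}=f^{\ast}+\overline{\lambda}e$ and norm $\Vert f+\lambda e\Vert=\Vert f\Vert+\vert\lambda\vert$. $A^{\ast}$ denotes the algebraic dual of $A$ (all linear functionals) and $A'$ the topological dual (all continuous linear functionals). A linear functional $f$ on $A$ (not assumed continuous) is positive if $f(x^{\ast}x)\geq 0$ for all $x\in A$; $P(A)$ is the set of all positive linear functionals on $A$, and $\mathrm{span}_{A^{\ast}}P(A)$ is its linear span in $A^{\ast}$. $R(A)$ is the (Jacobson) radical of $A$; $A$ is semisimple if $R(A)=\{0\}$, and an algebra is radical if it equals its own radical. An algebra with identity $e$ and involution is symmetric if $(e+x^{\ast}x)^{-1}$ exists for all $x$; for an algebra without identity, symmetric means that $-x^{\ast}x$ is quasi-regular for all $x$ (equivalently, $e+x^{\ast}x$ is invertible in the algebra with identity adjoined). BP*-algebra: a locally convex algebra is an algebra over $\mathbb{C}$ which is a Hausdorff locally convex topological vector space with separately continuous multiplication. Let $A$ be a commutative locally convex algebra with identity $e$ and continuous involution. Let $\beta$ be the family of all closed, bounded, absolutely convex, hermitian ($B^{\ast}=B$), idempotent ($BB\subset B$) subsets $B$ of $A$ containing $e$. For $B\in\beta$, let $A_{B}$ be the linear span of $B$, normed by the Minkowski functional $\Vert\cdot\Vert_{B}$ of $B$. $A$ is a BP*-algebra if $A=\bigcup\{A_{B}:B\in\beta\}$ and $(A_{B},\Vert\cdot\Vert_{B})$ is complete for every $B\in\beta$. *)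

(* Defs.v *)
From HB Require Import structures.
From mathcomp Require Import all_boot all_order all_algebra.
From mathcomp Require Import all_classical all_reals all_analysis.
From mathcomp Require Import measurable_realfun generic_quotient ring_quotient.
From mathcomp.real_closed Require Import complex.

Set Implicit Arguments.
Unset Strict Implicit.
Unset Printing Implicit Defensive.
Import Order.TTheory GRing.Theory Num.Theory.
Import numFieldNormedType.Exports.

Local Open Scope classical_set_scope.
Local Open Scope ring_scope.
Local Open Scope complex_scope.

(** Algebras over the complex numbers need not have an identity, so they are
    given by an [lmodType R[i]] together with an explicit multiplication. *)
Section StarAlgebras.
Context (R : realType) (V : lmodType R[i]).
Implicit Types (mul : V -> V -> V) (star : V -> V) (e x : V) (L : set V).

Record is_algebra mul : Prop := IsAlgebra {
  algebra_mulA : associative mul;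
  algebra_linearl : forall y, linear (mul^~ y);
  algebra_linearr : forall x, linear (mul x) }.

Record is_involution mul star : Prop := IsInvolution {
  involution_semilinear : forall (a : R[i]) x y,
    star (a *: x + y) = a^* *: star x + star y;
  involution_mul : forall x y, star (mul x y) = mul (star y) (star x);
  involution_invol : involutive star }.

Definition is_identity mul e := left_id e mul /\ right_id e mul.

Definition invertible mul e x := exists y, mul x y = e /\ mul y x = e.

(** In an algebra with identity [e], this says that [e - x] is invertible,
    with inverse [e - y]. *)
Definition quasi_regular mul x :=
  exists y, x + y - mul x y = 0 /\ x + y - mul y x = 0.

Definition symmetric_unital mul star e :=
  forall x, invertible mul e (e + mul (star x) x).

Definition symmetric_nonunital mul star :=
  forall x, quasi_regular mul (- mul (star x) x).

Record left_ideal mul L : Prop := LeftIdeal {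
  left_ideal0 : L 0;
  left_ideal_linear : forall (a : R[i]) x y, L x -> L y -> L (a *: x + y);
  left_ideal_mul : forall a x, L x -> L (mul a x) }.

(** Modular (or regular) ideal: [u] is a right identity modulo [L].  In an
    algebra with identity every left ideal is modular. *)
Definition modular mul L := exists u, forall x, L (x - mul x u).

Definition maximal_modular_left_ideal mul L :=
  [/\ left_ideal mul L, modular mul L, L <> setT &
      forall M, left_ideal mul M -> L `<=` M -> M = L \/ M = setT].

(** Jacobson radical; it is the whole algebra when there is no maximal modular
    left ideal. *)
Definition radical mul : set V :=
  \bigcap_(L in maximal_modular_left_ideal mul) L.

Definition semisimple mul := radical mul = [set 0].

Definition radical_algebra mul := radical mul = setT.

(** Continuity is not required; [0 <= z] in [R[i]] includes that [z] is
    real. *)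
Definition positive_functionals mul star : set (V -> R[i]^o) :=
  [set f : V -> R[i]^o | linear f /\ forall x, 0 <= (f (mul (star x) x) : R[i])].

End StarAlgebras.

(** For functionals, the ambient space is the module [V -> K^o] of all
    functions; the span of a set of linear functionals is the same there as in
    the algebraic dual. *)
Definition lin_span (K : numDomainType) (V : lmodType K) (S : set V) : set V :=
  [set x | exists n (c : 'I_n -> K) (v : 'I_n -> V),
     (forall i, S (v i)) /\ x = \sum_i c i *: v i].

Section BPstar.
Context (R : realType) (V : tvsType R[i]).
Implicit Types (mul : V -> V -> V) (star : V -> V) (e x : V) (B : set V).

Definition topological_dual : set (V -> R[i]^o) :=
  [set f : V -> R[i]^o | linear f /\ continuous f].

(** [tvsType] includes local convexity, but not the Hausdorff axiom. *)
Record is_locally_convex_algebra mul : Prop := IsLocallyConvexAlgebra {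
  lca_algebra : is_algebra mul;
  lca_hausdorff : hausdorff_space V;
  lca_continuousl : forall y, continuous (mul^~ y);
  lca_continuousr : forall x, continuous (mul x) }.

Definition tvs_bounded B := forall U : set V, nbhs 0 U ->
  exists2 r : R[i], 0 < r &
    forall a : R[i], r <= `|a| -> B `<=` [set a *: u | u in U].

Definition absolutely_convex B := forall (a b : R[i]) x y,
  `|a| + `|b| <= 1 -> B x -> B y -> B (a *: x + b *: y).

(** The members of the family usually denoted [beta]. *)
Record bp_disk mul star e B : Prop := BPDisk {
  bp_disk_closed : closed B;
  bp_disk_bounded : tvs_bounded B;
  bp_disk_absconvex : absolutely_convex B;
  bp_disk_hermitian : star @` B = B;
  bp_disk_idempotent : forall x y, B x -> B y -> B (mul x y);
  bp_disk_identity : B e }.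

Definition minkowski B x : R :=
  inf [set r : R | 0 < r /\ exists2 b, B b & x = r%:C *: b].

(** Completeness of [lin_span B] for the norm [minkowski B]. *)
Definition disk_complete B := forall u : nat -> V,
  (forall n, lin_span B (u n)) ->
  (forall eps : R, 0 < eps -> exists N, forall m n, (N <= m)%N -> (N <= n)%N ->
     minkowski B (u m - u n) < eps) ->
  exists2 l, lin_span B l & minkowski B (u n - l) @[n --> \oo] --> (0 : R).

Record is_BPstar_algebra mul star e : Prop := IsBPstarAlgebra {
  bpstar_lca : is_locally_convex_algebra mul;
  bpstar_comm : commutative mul;
  bpstar_identity : is_identity mul e;
  bpstar_involution : is_involution mul star;
  bpstar_continuous_star : continuous star;
  bpstar_cover : setT = \bigcup_(B in bp_disk mul star e) lin_span B;
  bpstar_complete : forall B, bp_disk mul star e B -> disk_complete B }.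

End BPstar.
Arguments topological_dual {R} V _.

Definition hennings_question (R : realType) :=
  forall (V : tvsType R[i]) (mul : V -> V -> V) (star : V -> V) (e : V),
    is_BPstar_algebra mul star e ->
    topological_dual V `<=` lin_span (positive_functionals mul star).

Section BanachStar.
Context (R : realType) (V : normedModType R[i]).
Implicit Types (mul : V -> V -> V) (star : V -> V).

Record is_banach_star_algebra mul star : Prop := IsBanachStarAlgebra {
  banach_algebra : is_algebra mul;
  banach_involution : is_involution mul star;
  banach_norm_mul : forall x y, `|mul x y| <= `|x| * `|y|;
  banach_norm_star : forall x, `|star x| = `|x|;
  banach_complete : forall F : set_system V, ProperFilter F -> cauchy F ->
    cvg F }.

End BanachStar.

(** [V] + C e, with the sum of the norms (the canonical norm on a product type
    is the maximum, hence the alias). *)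
Section Unitization.
Context (R : realType) (V : normedModType R[i]).

Definition unitization : Type := (V * R[i]^o)%type.

HB.instance Definition _ :=
  GRing.Lmodule.copy unitization (V * R[i]^o)%type.

Definition unitization_norm (x : unitization) : R[i] := `|x.1| + `|x.2 : R[i]|.

Lemma unitization_normD x y :
  unitization_norm (x + y) <= unitization_norm x + unitization_norm y.
Proof.
rewrite /unitization_norm addrACA; apply: lerD; exact: ler_normD.
Qed.

Lemma unitization_normZ (a : R[i]) x :
  unitization_norm (a *: x) = `|a| * unitization_norm x.
Proof. by rewrite /unitization_norm mulrDr normrZ normrM. Qed.

Lemma unitization_norm_eq0 x : unitization_norm x = 0 -> x = 0.
Proof.
case: x => x a /eqP; rewrite /unitization_norm paddr_eq0// => /andP[/=].
by rewrite !normr_eq0 => /eqP -> /eqP ->.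
Qed.

HB.instance Definition _ := Lmodule_isNormed.Build R[i] unitization
  unitization_normD unitization_normZ unitization_norm_eq0.

Lemma unitization_normE (x : unitization) : `|x| = `|x.1| + `|x.2 : R[i]|.
Proof. by []. Qed.

Variables (mul : V -> V -> V) (star : V -> V).

Definition unit_inj (x : V) : unitization := (x, 0).

Definition unit_one : unitization := (0, 1).

Definition unit_mul (x y : unitization) : unitization :=
  (mul x.1 y.1 + y.2 *: x.1 + x.2 *: y.1, x.2 * y.2).

Definition unit_star (x : unitization) : unitization :=
  (star x.1, (x.2 : R[i])^*).

End Unitization.

Section ComplexIntegral.
Context d (T : measurableType d) (R : realType).
Variables (mu : {measure set T -> \bar R}) (D : set T).
Implicit Types f g : T -> R[i].

Definition cintegrable f : Prop :=
  mu.-integrable D (EFin \o (@complex.Re R \o f)) /\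
  mu.-integrable D (EFin \o (@complex.Im R \o f)).

Definition cintegral f : R[i] :=
  (\int[mu]_(t in D) complex.Re (f t)) +i*
  (\int[mu]_(t in D) complex.Im (f t)).

Hypothesis mD : measurable D.

Lemma measurable_normc f : cintegrable f ->
  measurable_fun D (fun t => Normc.normc (f t)).
Proof.
move=> [/measurable_int/measurable_EFinP mr /measurable_int/measurable_EFinP mi].
have -> : (fun t => Normc.normc (f t)) =
    Num.sqrt \o (fun t => complex.Re (f t) ^+ 2 + complex.Im (f t) ^+ 2).
  by apply/funext => t /=; case: (f t).
apply: measurableT_comp.
  by apply: continuous_measurable_fun; exact: sqrt_continuous.
by apply: measurable_funD; exact: measurable_funX.
Qed.

Lemma integrable_normc f : cintegrable f ->
  mu.-integrable D (EFin \o (fun t => Normc.normc (f t))).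
Proof.
move=> fD; have [fr fi] := fD.
have fri := integrableD mD (integrable_abse fr) (integrable_abse fi).
apply: (le_integrable mD _ _ fri).
  by apply/measurable_EFinP; exact: measurable_normc.
move=> t _ /=; rewrite lee_fin; case: (f t) => a b /=.
rewrite [leRHS]ger0_norm ?addr_ge0// ger0_norm ?sqrtr_ge0//.
rewrite -[leRHS]ger0_norm ?addr_ge0// -sqrtr_sqr ler_wsqrtr//.
by rewrite sqrrD !real_normK ?num_real// addrAC lerDl mulrn_wge0// mulr_ge0.
Qed.

Lemma cintegrable_lin (a : R[i]) f g :
  cintegrable f -> cintegrable g -> cintegrable (fun t => a * f t + g t).
Proof.
move=> [fr fi] [gr gi]; case: a => a b; split.
- have := integrableD mD (integrableD mD (integrableZl mD a fr)
    (integrableZl mD (- b) fi)) gr.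
  apply: eq_integrable => // t _ /=.
  by case: (f t) (g t) => ? ? [? ?] /=; rewrite -!EFinM mulNr.
- have := integrableD mD (integrableD mD (integrableZl mD a fi)
    (integrableZl mD b fr)) gi.
  apply: eq_integrable => // t _ /=.
  by case: (f t) (g t) => ? ? [? ?] /=.
Qed.

End ComplexIntegral.

(** Integrable complex functions on [0,1], as functions on the whole line whose
    values outside of [0,1] are irrelevant. *)
Section L1.
Context (R : realType).

Local Notation mu := (@lebesgue_measure R).
Local Notation I01 := (`[0, 1]%classic : set (measurableTypeR R)).
Local Notation fct := (R -> R[i]^o).

Lemma measurable_I01 : measurable I01.
Proof. exact: measurable_itv. Qed.
Hint Resolve measurable_I01 : core.

Definition l1fun_pred : {pred fct} := [pred f : fct | `[< cintegrable mu I01 f >]].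

Lemma l1fun_submod_closed : submod_closed l1fun_pred.
Proof.
split=> [|a f g].
  by apply/asboolP; split; exact: (integrable0 mu I01).
by move=> /asboolP fi /asboolP gi; apply/asboolP; exact: cintegrable_lin.
Qed.

HB.instance Definition _ :=
  GRing.isSubmodClosed.Build R[i] fct l1fun_pred l1fun_submod_closed.

Record l1fun := L1Fun { l1fun_val :> fct; l1funP : l1fun_val \in l1fun_pred }.

HB.instance Definition _ := [isSub for l1fun_val].
HB.instance Definition _ := [Choice of l1fun by <:].
HB.instance Definition _ := [SubChoice_isSubLmodule of l1fun by <:].

Definition l1null : {pred l1fun} :=
  [pred f : l1fun | `[< ae_eq mu I01 f (0 : fct) >]].

Lemma l1null_submod_closed : submod_closed l1null.
Proof.
split=> [|a f g]; first by apply/asboolP; exact: ae_eq_refl.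
move=> /asboolP f0 /asboolP g0; apply/asboolP.
move: f0 g0; apply: filterS2 => t /= f0 g0 It.
rewrite [LHS]/(a *: f t + g t) (f0 It : f t = 0) (g0 It : g t = 0).
by apply: etrans (addr0 _) _; exact: scaler0.
Qed.

HB.instance Definition _ := GRing.isSubmodClosed.Build R[i] l1fun l1null
  l1null_submod_closed.

Definition L1 := {ideal_quot l1null}.

HB.instance Definition _ := GRing.Zmodule.on L1.

Lemma l1_eqP (f g : l1fun) :
  (\pi_L1 f = \pi_L1 g)%qT <-> ae_eq mu I01 (f : fct) (g : fct).
Proof.
have -> : (\pi_L1 f = \pi_L1 g)%qT <-> f - g \in l1null.
  by rewrite Quotient.idealrBE; split => [->|/eqP].
split=> [/asboolP|fg]; last apply/asboolP; last move: fg;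
  apply: filterS => t /= fg It; move: (fg It).
  by move=> /eqP; rewrite subr_eq0 => /eqP.
by move=> fgt; apply/eqP; rewrite [_ == _]subr_eq0; apply/eqP.
Qed.

Lemma l1_piP (u : L1) : exists f : l1fun, u = (\pi_L1 f)%qT.
Proof. by exists (repr u); rewrite [RHS]reprK. Qed.

Lemma l1_piD (f g : l1fun) :
  (\pi_L1 f + \pi_L1 g)%qT = (\pi_L1 (f + g))%qT.
Proof. by symmetry; apply: (Quotient.pi_add l1null). Qed.

Definition l1_scale (a : R[i]) (u : L1) : L1 := (\pi_L1 (a *: repr u))%qT.

Lemma l1_piZ (a : R[i]) (f : l1fun) :
  l1_scale a (\pi_L1 f)%qT = (\pi_L1 (a *: f))%qT.
Proof.
apply/l1_eqP; have /l1_eqP := reprK (\pi_L1 f)%qT.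
apply: filterS => t fE It.
exact: (congr1 (fun z : R[i]^o => a *: z) (fE It)).
Qed.

Fact l1_scaleA (a b : R[i]) u :
  l1_scale a (l1_scale b u) = l1_scale (a * b) u.
Proof. by have [f ->] := l1_piP u; rewrite !l1_piZ scalerA. Qed.

Fact l1_scale1 : left_id 1 l1_scale.
Proof. by move=> u; have [f ->] := l1_piP u; rewrite l1_piZ scale1r. Qed.

Fact l1_scaleDr : right_distributive l1_scale +%R.
Proof.
move=> a u v; have [f ->] := l1_piP u; have [g ->] := l1_piP v.
by rewrite l1_piD !l1_piZ l1_piD scalerDr.
Qed.

Fact l1_scaleDl u : {morph l1_scale^~ u : a b / a + b}.
Proof.
by move=> a b; have [f ->] := l1_piP u; rewrite !l1_piZ l1_piD scalerDl.
Qed.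

HB.instance Definition _ := GRing.Zmodule_isLmodule.Build R[i] L1
  l1_scaleA l1_scale1 l1_scaleDr l1_scaleDl.

Definition l1_normr (f : fct) : R := \int[mu]_(t in I01) Normc.normc (f t).

Definition l1_norm (u : L1) : R[i] := (l1_normr (repr u))%:C.

Lemma l1fun_integrable (f : l1fun) : cintegrable mu I01 f.
Proof. by have /asboolP := l1funP f. Qed.
Hint Resolve l1fun_integrable : core.

Lemma l1_pi_norm (f : l1fun) : l1_norm (\pi_L1 f)%qT = (l1_normr f)%:C.
Proof.
congr (_ %:C); congr fine; apply: ae_eq_integral => //.
- by apply/measurable_EFinP; exact: measurable_normc.
- by apply/measurable_EFinP; exact: measurable_normc.
have /l1_eqP := reprK (\pi_L1 f)%qT.
by apply: filterS => t fE It; congr (Normc.normc _)%:E; exact: fE.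
Qed.

Fact l1_normD u v : l1_norm (u + v) <= l1_norm u + l1_norm v.
Proof.
have [f ->] := l1_piP u; have [g ->] := l1_piP v.
rewrite l1_piD !l1_pi_norm -rmorphD lecR.
rewrite /l1_normr -RintegralD//; try exact: integrable_normc.
apply: le_Rintegral => //; first exact: integrable_normc.
  have := integrableD measurable_I01 (integrable_normc measurable_I01 (l1fun_integrable f))
   (integrable_normc measurable_I01 (l1fun_integrable g)).
  exact: eq_integrable.
by move=> t _; exact: le_normcD.
Qed.

Fact l1_normZ (a : R[i]) u : l1_norm (a *: u) = `|a| * l1_norm u.
Proof.
have [f ->] := l1_piP u; rewrite [_ *: _]l1_piZ !l1_pi_norm.
rewrite -[`|a|]/((Normc.normc a)%:C) -rmorphM; congr (_ %:C).
rewrite /l1_normr -RintegralZl//; last exact: integrable_normc.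
by apply: eq_Rintegral => t _; exact: Normc.normcM.
Qed.

Fact l1_norm_eq0 u : l1_norm u = 0 -> u = 0.
Proof.
have [f ->] := l1_piP u; rewrite l1_pi_norm => -[f0].
have fi := integrable_normc measurable_I01 (l1fun_integrable f).
have /(ae_eq_integral_abs mu measurable_I01 (measurable_int _ fi)) f_ae :
    (\int[mu]_(t in I01) `|(Normc.normc (f t))%:E|)%E = 0%R.
  transitivity ((l1_normr f)%:E); last by rewrite f0.
  rewrite /l1_normr /Rintegral fineK; last exact: integrable_fin_num.
  apply: eq_integral => t _ /=; rewrite ger0_norm//.
  by case: (f t) => x y; exact: sqrtr_ge0.
have <- : (\pi_L1 0)%qT = 0 by exact: pi_zeror.
apply/l1_eqP; move: f_ae; apply: filterS => t ft It.
by apply: Normc.eq0_normc; case: (ft It).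
Qed.

HB.instance Definition _ := Lmodule_isNormed.Build R[i] L1
  l1_normD l1_normZ l1_norm_eq0.

(** Class of an integrable function; [0] when [f] is not integrable on [0,1]. *)
Definition l1_class (f : fct) : L1 := (\pi_L1 (insubd (0 : l1fun) f))%qT.

Definition convolution (f g : fct) : fct :=
  fun x => cintegral mu `[0, x] (fun t => f (x - t) * g t).

Lemma l1_classE (f : l1fun) : l1_class f = (\pi_L1 f)%qT.
Proof. by rewrite /l1_class valKd. Qed.

Lemma l1_class_surj (u : L1) :
  exists2 f : fct, cintegrable mu I01 f & u = l1_class f.
Proof. by have [f ->] := l1_piP u; exists f; rewrite ?l1_classE. Qed.

Lemma l1_class_eq (f g : fct) : cintegrable mu I01 f -> cintegrable mu I01 g ->
  l1_class f = l1_class g <-> ae_eq mu I01 f g.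
Proof.
move=> /asboolP fi /asboolP gi.
by rewrite -[f]/(L1Fun fi : fct) -[g]/(L1Fun gi : fct) !l1_classE l1_eqP.
Qed.

Lemma l1_class_norm (f : fct) : cintegrable mu I01 f ->
  `|l1_class f| = (\int[mu]_(t in I01) Normc.normc (f t))%:C.
Proof.
by move=> /asboolP fi; rewrite -[f]/(L1Fun fi : fct) l1_classE [LHS]l1_pi_norm.
Qed.

(** The convolution of integrable functions is only defined almost everywhere;
    that it is integrable, and that the two operations below do not depend on
    the representatives, is not part of these definitions. *)
Definition l1_mul (u v : L1) : L1 :=
  l1_class (convolution (repr u) (repr v)).

Definition l1_star (u : L1) : L1 := l1_class (fun x => (repr u x)^*).

End L1.

(* Main.v *)
Require Import Defs.
From HB Require Import structures.
From mathcomp Require Import all_boot all_order all_algebra.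
From mathcomp Require Import all_classical all_reals all_analysis.
From mathcomp.real_closed Require Import complex.
From mathcomp Require Import measurable_realfun ring lra.
Import Order.TTheory GRing.Theory Num.Theory.
Import numFieldNormedType.Exports.
Set Implicit Arguments.
Unset Strict Implicit.
Unset Printing Implicit Defensive.
Local Open Scope classical_set_scope.
Local Open Scope ring_scope.
Local Open Scope complex_scope.

(** The convolution algebra E = L^1[0,1] has many *-automorphisms. For real l the
    dilation f |-> exp (l t) f(t) commutes with convolution, because
    exp (l (x - t)) exp (l t) = exp (l x), and with the involution, and it is
    inverted by the dilation with exponent - l. By dominated convergence the norm
    of exp (- n t) f(t) tends to 0 ([l1_dilation_norm_cvg]). Hence any property
    that is invariant under *-automorphisms and holds for the small elements of E
    holds for all its elements. Two such properties are used, each solved by a contraction: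
    - the fixed point of y |-> uy - u is a quasi-inverse of u
      ([l1_quasi_regular]);
    - if h is hermitian, the fixed point of y |-> (h + y^2)/2 is hermitian and
      satisfies (e - y)^2 = e - h ([l1_quasi_sqrt]).

    The first one implies that E has no maximal modular left ideal, and that
    f + a e is invertible in A = E + C e as soon as a is not 0. So E and A are
    symmetric, and E is the only maximal left ideal of A ([unit_radical]). By the
    second one a positive functional F on A satisfies F e - t F h >= 0 for all
    hermitian h in E and all real t, whence F h = 0; so all combinations of
    positive functionals vanish on E ([positive_vanish]), whereas the integral
    is a nonzero continuous functional on E ([dual_not_in_span]). Finally any
    commutative Banach *-algebra with an identity of norm 1 is a BP*-algebra
    ([banach_is_BPstar]): the closed unit ball is one of the disks that have to
    exhaust the algebra, and each of the disks B is bounded and closed for the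
    norm, from which the completeness of A_B follows.

    That E is a Banach *-algebra rests on the integrability of the kernel
    f(x - t) g(t) over the plane, f and g being extended by zero
    ([cintegrable_ckernel_prod]): Tonelli's theorem and the invariance of Lebesgue
    measure bound it by the product of the norms, and Fubini's theorem gives
    the rest. Associativity is a trilinear identity, so it suffices to prove it for
    nonnegative functions ([l1_mul_cycle]), where Tonelli's theorem applies to
    functions with values in [0,+oo]. For completeness, a sequence whose
    increments have norms at most 2^-n converges almost everywhere and dominatedly
    ([L1_complete]). *)

(** * Lebesgue measure and convolution of nonnegative functions *)

(** The instance of [filterS2] for almost everywhere properties, whose conclusion
    also unifies with [ae_eq]. *)
Lemma ae_imply2 d (T : measurableType d) (R : realType)
    (mu : {measure set T -> \bar R}) (P Q S : T -> Prop) :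
  {ae mu, forall t, P t} -> {ae mu, forall t, Q t} ->
  (forall t, P t -> Q t -> S t) -> {ae mu, forall t, S t}.
Proof. by move=> aP aQ PQS; move: aP aQ; apply: filterS2. Qed.

Section TranslationInvariance.
Context (R : realType).
Local Notation mu := (@lebesgue_measure R).
Local Notation LR := (measurableTypeR R).

Definition reflect_at (x : R) : LR -> LR := fun t => x - t.

Lemma measurable_reflect_at x : measurable_fun setT (reflect_at x).
Proof. exact: measurable_funB. Qed.

(** The reflection t |-> x - t, rather than a translation, is what convolution
    needs; translations are composites of two reflections. *)
Lemma lebesgue_measure_reflect_at x (A : set LR) : measurable A ->
  pushforward mu (reflect_at x) A = mu A.
Proof.
move=> mA; apply/esym/lebesgue_measure_unique => //=.
  exact: measurable_reflect_at.
move=> ? _ [[a b]] _ <-.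
rewrite /pushforward.
have -> : reflect_at x @^-1` [set` `]a, b]] = [set` `[x - b, x - a[].
  apply/seteqP; split => t /=; rewrite /reflect_at !in_itv/= => /andP[? ?];
    apply/andP; split; lra.
rewrite !lebesgue_measure_itv/= !lte_fin.
have -> : (x - b < x - a) = (a < b) by lra.
by case: ifP => // _; rewrite -!EFinB; congr (_%:E); lra.
Qed.

Local Open Scope ereal_scope.

Lemma ge0_integral_reflect_at x (f : LR -> \bar R) :
  measurable_fun setT f -> (forall t, 0 <= f t) ->
  \int[mu]_t f (x - t)%R = \int[mu]_t f t.
Proof.
move=> mf f0.
rewrite -[LHS]/(\int[mu]_(t in reflect_at x @^-1` setT) (f \o reflect_at x) t).
rewrite -(ge0_integral_pushforward (measurable_reflect_at x))//.
apply: eq_measure_integral => [|? A mA _]; first exact: measurable_reflect_at.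
exact: lebesgue_measure_reflect_at.
Qed.

(** Both sides are differences of integrals of nonnegative functions, hence
    integrability is not an issue. *)
Lemma integral_reflect_at x (f : LR -> \bar R) : measurable_fun setT f ->
  \int[mu]_t f (x - t)%R = \int[mu]_t f t.
Proof.
move=> mf; rewrite -[LHS]/(\int[mu]_t (f \o reflect_at x) t).
rewrite integralE [RHS]integralE funepos_comp funeneg_comp/=.
rewrite !(@ge0_integral_reflect_at x)//; first exact: measurable_funeneg.
exact: measurable_funepos.
Qed.

Lemma ge0_integral_translate a (f : LR -> \bar R) :
  measurable_fun setT f -> (forall t, 0 <= f t) ->
  \int[mu]_t f (t - a)%R = \int[mu]_t f t.
Proof.
move=> mf f0; rewrite -(ge0_integral_reflect_at 0 mf f0).
rewrite -(@ge0_integral_reflect_at a (fun t => f (0 - t)%R))//; last first.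
  exact: measurableT_comp (measurable_reflect_at 0).
by apply: eq_integral => t _; congr f; lra.
Qed.

Lemma ae_reflect_at x (P : R -> Prop) :
  {ae mu, forall t, P t} -> {ae mu, forall t, P (x - t)%R}.
Proof.
move=> [N [mN N0 PN]]; exists (reflect_at x @^-1` N); split.
- by rewrite -[X in measurable X]setTI; exact: measurable_reflect_at.
- by rewrite -N0; exact: lebesgue_measure_reflect_at.
- by move=> t /= nP; apply: PN.
Qed.

(** Convolution on the whole line of functions with values in [0,+oo]: it is
    defined at every point, and Tonelli's theorem applies without any
    integrability assumption. *)
Definition econv (F G : LR -> \bar R) (x : LR) : \bar R :=
  \int[mu]_t (F (x - t)%R * G t).

Section nonneg.
Variables F G : LR -> \bar R.
Hypotheses (mF : measurable_fun setT F) (F0 : forall t, 0 <= F t).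
Hypotheses (mG : measurable_fun setT G) (G0 : forall t, 0 <= G t).

Lemma econv_ge0 x : 0 <= econv F G x.
Proof. by apply: integral_ge0 => t _; exact: mule_ge0. Qed.

Lemma measurable_econv_kernel :
  measurable_fun setT (fun z : LR * LR => F (z.1 - z.2)%R * G z.2).
Proof.
apply: emeasurable_funM; last exact: measurableT_comp.
by apply: (measurableT_comp mF); exact: measurable_funB.
Qed.

Lemma measurable_econv : measurable_fun setT (econv F G).
Proof.
apply: (measurable_fun_fubini_tonelli_F _ measurable_econv_kernel) => z.
exact: mule_ge0.
Qed.

Lemma econvC x : econv F G x = econv G F x.
Proof.
rewrite /econv -[RHS](ge0_integral_reflect_at x)//.
- by apply: eq_integral => t _; rewrite muleC; congr (G _ * _); lra.
- by apply: emeasurable_funM => //; exact: measurableT_comp (measurable_reflect_at x).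
- by move=> t; exact: mule_ge0.
Qed.

(** Tonelli's theorem: integrating first in x, the inner integral of F (x - t) is
    the integral of F by invariance under translation. *)
Lemma integral_econv :
  \int[mu]_x econv F G x = (\int[mu]_x F x) * (\int[mu]_x G x).
Proof.
rewrite (@fubini_tonelli _ _ _ _ _ mu mu _ measurable_econv_kernel)/=; last first.
  by move=> z; exact: mule_ge0.
rewrite /fubini_G/= -ge0_integralZl//; last exact: integral_ge0.
apply: eq_integral => t _; rewrite ge0_integralZr//.
- by rewrite ge0_integral_translate.
- by apply: (measurableT_comp mF); exact: measurable_funB.
Qed.

End nonneg.

(** In both sides the integrand is H (x - s) F (s - t) G t, up to a translation in
    s. In presence of commutativity this cyclic form is equivalent to
    associativity, and it always keeps the inner convolution in the variable of
    integration, where a change on a null set is harmless. *)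
Lemma econv_cycle (F G H : LR -> \bar R) x :
  measurable_fun setT F -> (forall t, 0 <= F t) ->
  measurable_fun setT G -> (forall t, 0 <= G t) ->
  measurable_fun setT H -> (forall t, 0 <= H t) ->
  econv H (econv F G) x = econv G (econv H F) x.
Proof.
move=> mF F0 mG G0 mH H0.
have mFG : measurable_fun setT (econv F G) by exact: measurable_econv.
pose k (z : LR * LR) := H (x - z.1)%R * (F (z.1 - z.2)%R * G z.2).
have mk : measurable_fun setT k.
  apply: emeasurable_funM; last exact: (measurable_econv_kernel mF mG).
  by apply: (measurableT_comp mH); exact: measurable_funB.
have k0 z : 0 <= k z by rewrite !mule_ge0.
transitivity (\int[mu]_s \int[mu]_t k (s, t)).
  apply: eq_integral => s _; rewrite /k/= ge0_integralZl//.
  - apply: emeasurable_funM => //.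
    by apply: (measurableT_comp mF); exact: measurable_funB.
  - by move=> t _; exact: mule_ge0.
rewrite (@fubini_tonelli _ _ _ _ _ mu mu k mk k0).
rewrite econvC//; [|exact: measurable_econv|by move=> t; exact: econv_ge0].
apply: eq_integral => t _; rewrite /fubini_G /k/=.
under eq_integral do rewrite muleA.
rewrite ge0_integralZr//.
- congr (_ * _); rewrite /econv -[RHS](ge0_integral_translate t).
  + by apply: eq_integral => s _; congr (H _ * _); lra.
  + by apply: emeasurable_funM => //; exact: measurableT_comp (measurable_reflect_at _).
  + by move=> s; exact: mule_ge0.
- apply: emeasurable_funM => //; first exact: measurableT_comp (measurable_reflect_at _).
  by apply: (measurableT_comp mF); exact: measurable_funB.
- by move=> s _; exact: mule_ge0.
Qed.
End TranslationInvariance.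

(** * Integrals of complex functions *)

Section ComplexMeasurable.
Context d (T : measurableType d) (R : realType).
Variable D : set T.
Implicit Types f g : T -> R[i].

(** Stated on components, as [cintegrable] is. *)
Definition cmeasurable f :=
  measurable_fun D (@complex.Re R \o f) /\ measurable_fun D (@complex.Im R \o f).

Lemma cmeasurableM f g : cmeasurable f -> cmeasurable g ->
  cmeasurable (fun t => f t * g t).
Proof.
move=> [fr fi] [gr gi]; split.
- have -> : @complex.Re R \o (fun t => f t * g t) =
    (fun t => complex.Re (f t) * complex.Re (g t) - complex.Im (f t) * complex.Im (g t)).
    by apply/funext => t /=; case: (f t); case: (g t).
  by apply: measurable_funB; exact: measurable_funM.
- have -> : @complex.Im R \o (fun t => f t * g t) =
    (fun t => complex.Re (f t) * complex.Im (g t) + complex.Im (f t) * complex.Re (g t)).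
    by apply/funext => t /=; case: (f t); case: (g t).
  by apply: measurable_funD; exact: measurable_funM.
Qed.

Lemma cmeasurable_normc f : cmeasurable f ->
  measurable_fun D (fun t => Normc.normc (f t)).
Proof.
move=> [mr mi].
have -> : (fun t => Normc.normc (f t)) =
    Num.sqrt \o (fun t => complex.Re (f t) ^+ 2 + complex.Im (f t) ^+ 2).
  by apply/funext => t /=; case: (f t).
apply: measurableT_comp.
  by apply: continuous_measurable_fun; exact: sqrt_continuous.
by apply: measurable_funD; exact: measurable_funX.
Qed.

End ComplexMeasurable.

Lemma cmeasurable_comp d d' (T : measurableType d) (T' : measurableType d')
    (R : realType) (f : T -> R[i]) (phi : T' -> T) :
  measurable_fun setT phi -> cmeasurable setT f -> cmeasurable setT (f \o phi).
Proof.
by move=> mphi [mr mi]; split; [exact: measurableT_comp mr mphi|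
  exact: measurableT_comp mi mphi].
Qed.

Section Normc.
Context (R : realType).
Implicit Types z : R[i].

Lemma normc_ge0 z : 0 <= Normc.normc z.
Proof. by case: z => a b; exact: sqrtr_ge0. Qed.

Lemma normc_Re z : `|complex.Re z| <= Normc.normc z.
Proof. by case: z => a b /=; rewrite -sqrtr_sqr ler_wsqrtr// lerDl sqr_ge0. Qed.

Lemma normc_Im z : `|complex.Im z| <= Normc.normc z.
Proof. by case: z => a b /=; rewrite -sqrtr_sqr ler_wsqrtr// lerDr sqr_ge0. Qed.

Lemma normcJ z : Normc.normc z^* = Normc.normc z.
Proof. by case: z => a b /=; rewrite sqrrN. Qed.

Lemma normcR (r : R) : Normc.normc r%:C = `|r|.
Proof. by rewrite /= expr0n addr0 sqrtr_sqr. Qed.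

End Normc.

Section ComplexIntegral.
Context d (T : measurableType d) (R : realType).
Variables (mu : {measure set T -> \bar R}) (D : set T).
Hypothesis mD : measurable D.
Implicit Types f g : T -> R[i].

Lemma cintegrable_measurable f : cintegrable mu D f -> cmeasurable D f.
Proof.
by move=> [/measurable_int/measurable_EFinP mr /measurable_int/measurable_EFinP mi].
Qed.

Lemma cintegrable_le f (g : T -> R) : cmeasurable D f ->
  mu.-integrable D (EFin \o g) -> (forall t, D t -> Normc.normc (f t) <= g t) ->
  cintegrable mu D f.
Proof.
move=> [mr mi] ig fg; split; apply: (le_integrable mD _ _ ig).
- exact/measurable_EFinP.
- move=> t Dt /=; rewrite lee_fin; apply: le_trans (ler_norm _).
  exact: le_trans (normc_Re _) (fg _ Dt).
- exact/measurable_EFinP.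
- move=> t Dt /=; rewrite lee_fin; apply: le_trans (ler_norm _).
  exact: le_trans (normc_Im _) (fg _ Dt).
Qed.

Lemma cintegral_lin (a : R[i]) f g : cintegrable mu D f -> cintegrable mu D g ->
  cintegral mu D (fun t => a * f t + g t) =
  a * cintegral mu D f + cintegral mu D g.
Proof.
move=> [fr fi] [gr gi]; case: a => a b; rewrite /cintegral.
have Z (c : R) (h : T -> R) : mu.-integrable D (EFin \o h) ->
    mu.-integrable D (EFin \o (fun t => c * h t)).
  by move=> ih; have := integrableZl mD c ih; exact: eq_integrable.
have A (h k : T -> R) : mu.-integrable D (EFin \o h) -> mu.-integrable D (EFin \o k) ->
    mu.-integrable D (EFin \o (fun t => h t + k t)).
  by move=> ih ik; have := integrableD mD ih ik; exact: eq_integrable.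
have lin (b1 b2 : R) (h k l : T -> R) : mu.-integrable D (EFin \o h) ->
    mu.-integrable D (EFin \o k) -> mu.-integrable D (EFin \o l) ->
    \int[mu]_(t in D) (b1 * h t + b2 * k t + l t) =
    b1 * \int[mu]_(t in D) h t + b2 * \int[mu]_(t in D) k t +
    \int[mu]_(t in D) l t.
  move=> ih ik il; rewrite RintegralD//; [|by apply: A; exact: Z].
  by rewrite RintegralD ?RintegralZl//; exact: Z.
transitivity ((a * \int[mu]_(t in D) complex.Re (f t) +
               - b * \int[mu]_(t in D) complex.Im (f t) +
               \int[mu]_(t in D) complex.Re (g t)) +i*
              (a * \int[mu]_(t in D) complex.Im (f t) +
               b * \int[mu]_(t in D) complex.Re (f t) +
               \int[mu]_(t in D) complex.Im (g t))).
  rewrite -!lin//; congr (_ +i* _); apply: eq_Rintegral => t _;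
    by case: (f t) (g t) => ? ? [? ?] /=; rewrite ?mulNr.
by apply/eqP; rewrite eq_complex/= mulNr !eqxx.
Qed.

Lemma cintegrable0 : cintegrable mu D (fun=> 0).
Proof. by split; exact: (integrable0 mu D). Qed.

Lemma cintegral0 : cintegral mu D (fun=> 0) = 0.
Proof. by rewrite /cintegral /Rintegral /= !integral0. Qed.

Lemma cintegrableZ (a : R[i]) f : cintegrable mu D f -> cintegrable mu D (fun t => a * f t).
Proof.
move=> fi; have := cintegrable_lin mD a fi cintegrable0.
by congr cintegrable; apply/funext => t; rewrite addr0.
Qed.

Lemma cintegralZ (a : R[i]) f : cintegrable mu D f ->
  cintegral mu D (fun t => a * f t) = a * cintegral mu D f.
Proof.
move=> fi; have := cintegral_lin a fi cintegrable0.
rewrite cintegral0 addr0 => <-; congr cintegral.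
by apply/funext => t; rewrite addr0.
Qed.

Lemma cintegrableJ f : cintegrable mu D f -> cintegrable mu D (fun t => (f t)^*).
Proof.
move=> [fr fi]; split.
  by apply: eq_integrable fr => // t _ /=; case: (f t).
have := integrableN fi; apply: eq_integrable => // t _ /=; by case: (f t).
Qed.

Lemma cintegralJ f : cintegrable mu D f ->
  cintegral mu D (fun t => (f t)^*) = (cintegral mu D f)^*.
Proof.
move=> [fr fi]; rewrite /cintegral/=; congr (_ +i* _).
  by apply: eq_Rintegral => t _; case: (f t).
rewrite -mulN1r -RintegralZl//; apply: eq_Rintegral => t _.
by rewrite mulN1r; case: (f t).
Qed.

(** Multiply by a complex number u of modulus 1 that makes u times the integral
    real and nonnegative; then the modulus of the integral is the integral of
    Re (u f), and Re (u f) <= |f|. *)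
Lemma normc_cintegral f : cintegrable mu D f ->
  Normc.normc (cintegral mu D f) <= \int[mu]_(t in D) Normc.normc (f t).
Proof.
move=> fi; set z := cintegral mu D f.
have [->|z0] := eqVneq z 0.
  by rewrite normcR normr0; apply: Rintegral_ge0 => t _; exact: normc_ge0.
have nz0 : Normc.normc z != 0 by apply: contra_neq z0 => /Normc.eq0_normc.
pose u : R[i] := (Normc.normc z)^-1%:C * z^*.
(* u rotates the integral z onto its modulus *)
have uz : u * z = (Normc.normc z)%:C.
  rewrite /u; move: nz0; case: z {z0 u} => a b /= nz0.
  have n2 : Num.sqrt (a ^+ 2 + b ^+ 2) ^+ 2 = a ^+ 2 + b ^+ 2.
    by rewrite sqr_sqrtr// addr_ge0// sqr_ge0.
  move: nz0 n2; set n := Num.sqrt _ => nz0 n2.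
  apply/eqP; rewrite eq_complex/=; apply/andP; split; apply/eqP.
    transitivity (n^-1 * (a ^+ 2 + b ^+ 2)); first by ring.
    by rewrite -n2; field.
  by ring.
have nu : Normc.normc u = 1.
  by rewrite Normc.normcM normcR normcJ ger0_norm ?mulVf// invr_ge0 normc_ge0.
have -> : Normc.normc z = complex.Re (u * z) by rewrite uz.
rewrite -cintegralZ//=; have [ur ui] := cintegrableZ u fi.
apply: le_Rintegral => //; first exact: integrable_normc.
move=> t _; apply: le_trans (ler_norm _) _; apply: le_trans (normc_Re _) _.
by rewrite Normc.normcM nu mul1r.
Qed.

Lemma ae_eq_cintegral f g : cmeasurable D f -> cmeasurable D g ->
  ae_eq mu D f g -> cintegral mu D f = cintegral mu D g.
Proof.
move=> [fr fi] [gr gi] fg; rewrite /cintegral; congr (_ +i* _); congr fine;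
  apply: ae_eq_integral => //; try exact/measurable_EFinP;
  by apply: filterS fg => t fg Dt /=; rewrite fg.
Qed.

(** Extension by zero outside of [D]. *)
Definition cut f t : R[i] := if t \in D then f t else 0.

Lemma cintegral_mkcond f : cintegral mu D f = cintegral mu setT (cut f).
Proof.
rewrite /cintegral !(Rintegral_mkcond mu D); congr (_ +i* _);
  by apply: eq_Rintegral => t _; rewrite /cut patchE; case: ifP.
Qed.

Lemma cintegrable_mkcond f : cintegrable mu D f <-> cintegrable mu setT (cut f).
Proof.
have E (p : R[i] -> R) : p 0 = 0 -> mu.-integrable D (EFin \o (p \o f)) <->
    mu.-integrable setT (EFin \o (p \o cut f)).
  move=> p0; rewrite (integrable_mkcond _ mD).
  have -> // : (EFin \o (p \o f)) \_ D = EFin \o (p \o cut f).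
  by apply/funext => t; rewrite patchE /cut/=; case: ifP => //; rewrite p0.
by rewrite /cintegrable !E.
Qed.

End ComplexIntegral.

(** * Convolution of integrable functions on the unit interval *)

Section Convolution.
Context (R : realType).
Local Notation mu := (@lebesgue_measure R).
Local Notation LR := (measurableTypeR R).
Local Notation I01 := (`[0, 1]%classic : set LR).
Local Notation cint f := (cintegrable mu I01 f).
Implicit Types f g : LR -> R[i].

Let mI01 : measurable I01. Proof. exact: measurable_I01. Qed.
Hint Resolve mI01 : core.

Definition cut01 f : LR -> R[i] := cut I01 f.


Lemma cut_itvE (a b : R) f t :
  cut (`[a, b]%classic : set LR) f t = if a <= t <= b then f t else 0.
Proof.
by rewrite /cut; congr (if _ then _ else _); apply/idP/idP; rewrite inE/= in_itv.
Qed.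

Lemma cut01_cint f : cint f -> cintegrable mu setT (cut01 f).
Proof. by move/(cintegrable_mkcond mu mI01). Qed.

Lemma cut01_measurable f : cint f -> cmeasurable setT (cut01 f).
Proof. by move/cut01_cint/cintegrable_measurable. Qed.

(** The integrand of the convolution, made into a function on the whole plane: for
    x in [0,1] it vanishes unless 0 <= t <= x. *)
Definition ckernel f g (x t : LR) : R[i] := cut01 f (x - t) * cut01 g t.

Lemma ckernelE f g x : 0 <= x <= 1 ->
  ckernel f g x = cut (`[0, x]%classic : set LR) (fun t => f (x - t) * g t).
Proof.
move=> /andP[x0 x1]; apply/funext => t; rewrite /ckernel /cut01 !cut_itvE.
case: (boolP (0 <= t <= x)) => [/andP[t0 tx]|h].
  have -> : 0 <= x - t <= 1 by apply/andP; split; lra.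
  by have -> : 0 <= t <= 1 by apply/andP; split; lra.
case: ifP => [/andP[? ?]|_]; last by rewrite mul0r.
case: ifP => [/andP[? ?]|_]; last by rewrite mulr0.
by exfalso; move/negP: h; apply; apply/andP; split; lra.
Qed.

Lemma convolutionE f g x : 0 <= x <= 1 ->
  convolution f g x = cintegral mu setT (ckernel f g x).
Proof. by move=> x01; rewrite ckernelE// /convolution cintegral_mkcond. Qed.

Lemma cintegrable_ckernelP f g x : 0 <= x <= 1 ->
  cintegrable mu `[0, x]%classic (fun t => f (x - t) * g t) <->
  cintegrable mu setT (ckernel f g x).
Proof. by move=> x01; rewrite ckernelE// -cintegrable_mkcond. Qed.

Lemma measurable_ckernel f g x : cint f -> cint g -> cmeasurable setT (ckernel f g x).
Proof.
move=> fi gi; apply: cmeasurableM; last exact: cut01_measurable.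
exact: cmeasurable_comp (measurable_reflect_at x) (cut01_measurable fi).
Qed.

(** The modulus of the extension by zero, as input for [econv]. *)
Definition abs_cut f : LR -> \bar R := fun t => (Normc.normc (cut01 f t))%:E.

Lemma abs_cut_ge0 f t : (0 <= abs_cut f t)%E.
Proof. by rewrite lee_fin normc_ge0. Qed.
Hint Resolve abs_cut_ge0 : core.

Lemma measurable_abs_cut f : cint f -> measurable_fun setT (abs_cut f).
Proof. by move=> fi; apply/measurable_EFinP/cmeasurable_normc/cut01_measurable. Qed.

Lemma integral_abs_cut f : cint f ->
  (\int[mu]_t abs_cut f t = (\int[mu]_(t in I01) Normc.normc (f t))%:E)%E.
Proof.
move=> fi; rewrite /Rintegral fineK; last first.
  by apply: integrable_fin_num => //; exact: integrable_normc.
rewrite [RHS]integral_mkcond; apply: eq_integral => t _.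
by rewrite /abs_cut /cut01 /cut patchE; case: ifP => // _; rewrite normcR normr0.
Qed.

Lemma econv_abs_cut f g x :
  (econv (abs_cut f) (abs_cut g) x = \int[mu]_t (Normc.normc (ckernel f g x t))%:E)%E.
Proof. by apply: eq_integral => t _; rewrite /ckernel Normc.normcM EFinM. Qed.

Lemma integral_econv_abs_cut f g : cint f -> cint g ->
  (\int[mu]_x econv (abs_cut f) (abs_cut g) x =
  (\int[mu]_(t in I01) Normc.normc (f t) * \int[mu]_(t in I01) Normc.normc (g t))%:E)%E.
Proof.
move=> fi gi; rewrite integral_econv//; [|exact: measurable_abs_cut..].
by rewrite !integral_abs_cut// EFinM.
Qed.

(** The iterated integral of the modulus is the product of the two norms. By
    Fubini's theorem this gives both the existence of the convolution at almost
    every point and its integrability. *)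
Lemma cintegrable_ckernel_prod f g : cint f -> cint g ->
  cintegrable (mu \x mu)%E setT (fun z : LR * LR => ckernel f g z.1 z.2).
Proof.
move=> fi gi.
have mK : cmeasurable setT (fun z : LR * LR => ckernel f g z.1 z.2).
  apply: cmeasurableM.
    apply: (@cmeasurable_comp _ _ LR (LR * LR)%type _ (cut01 f) (fun z => z.1 - z.2)).
      exact: measurable_funB.
    exact: cut01_measurable.
  apply: (@cmeasurable_comp _ _ LR (LR * LR)%type _ (cut01 g) snd).
    exact: measurable_snd.
  exact: cut01_measurable.
apply: (cintegrable_le measurableT mK (g := fun z => Normc.normc (ckernel f g z.1 z.2))) => //.
apply/integrable12ltyP; first exact/measurable_EFinP/cmeasurable_normc.
rewrite (_ : (\int[mu]_x _)%E = (\int[mu]_x econv (abs_cut f) (abs_cut g) x)%E).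
  by rewrite integral_econv_abs_cut// ltry.
apply: eq_integral => x _; rewrite econv_abs_cut; apply: eq_integral => t _.
by rewrite /= ger0_norm ?normc_ge0.
Qed.

Lemma ae_cintegrable_ckernel f g : cint f -> cint g ->
  {ae mu, forall x, cintegrable mu setT (ckernel f g x)}.
Proof.
move=> fi gi; have [kr ki] := cintegrable_ckernel_prod fi gi.
have := ae_integrable1 kr; have := ae_integrable1 ki.
by apply: filterS2 => x /= h1 h2; split.
Qed.

(** An integrable extended-real function is finite almost everywhere, so passing
    to real values is harmless. *)
Lemma integrable_fine d (T : measurableType d) (m : {measure set T -> \bar R})
    (h : T -> \bar R) :
  m.-integrable setT h -> m.-integrable setT (EFin \o (fine \o h)).
Proof.
move=> hi; apply: (le_integrable measurableT _ _ hi).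
  by apply/measurable_EFinP; exact: measurableT_comp (measurable_int _ hi).
by move=> t _ /=; case: (h t) => //= *; rewrite ?normr0 ?lee0y ?leey ?leNye.
Qed.

Lemma cintegrable_ckernel_int f g : cint f -> cint g ->
  cintegrable mu setT (fun x => cintegral mu setT (ckernel f g x)).
Proof.
move=> fi gi; have [kr ki] := cintegrable_ckernel_prod fi gi.
by split; [have := integrable_fine (integrable_fubini_F kr)|
           have := integrable_fine (integrable_fubini_F ki)].
Qed.

Lemma eq_cint f g : (forall x, 0 <= x <= 1 -> f x = g x) -> cint f -> cint g.
Proof.
move=> fg [fr ffi]; split; [apply: eq_integrable fr|apply: eq_integrable ffi] => //;
  by move=> t; rewrite inE/= in_itv/= => t01; rewrite fg.
Qed.

Lemma cint_convolution f g : cint f -> cint g -> cint (convolution f g).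
Proof.
move=> fi gi.
apply: (@eq_cint (fun x => cintegral mu setT (ckernel f g x))).
  by move=> x x01; rewrite convolutionE.
have [cr ci] := cintegrable_ckernel_int fi gi.
by split; [apply: integrableS cr|apply: integrableS ci].
Qed.

(** Since null sets are preserved by t |-> x - t, the integrands agree almost
    everywhere for each fixed x, not only for almost every x. *)
Lemma convolution_ae f f' g g' x : cint f -> cint f' -> cint g -> cint g' ->
  ae_eq mu I01 f f' -> ae_eq mu I01 g g' -> 0 <= x <= 1 ->
  convolution f g x = convolution f' g' x.
Proof.
move=> fi f'i gi g'i ff gg x01; rewrite !convolutionE//.
apply: ae_eq_cintegral => //; try exact: measurable_ckernel.
have /(ae_reflect_at x) ff' : {ae mu, forall t, cut01 f t = cut01 f' t}.
  apply: filterS ff => t h; rewrite /cut01 /cut; case: ifP => //.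
  by rewrite inE => /h.
have gg' : {ae mu, forall t, cut01 g t = cut01 g' t}.
  apply: filterS gg => t h; rewrite /cut01 /cut; case: ifP => //.
  by rewrite inE => /h.
by apply: (ae_imply2 ff' gg') => t h1 h2 _; rewrite /ckernel h1 h2.
Qed.

Lemma convolutionC f g x : cint f -> cint g -> 0 <= x <= 1 ->
  convolution f g x = convolution g f x.
Proof.
move=> fi gi x01; rewrite !convolutionE//.
have [mr mi] := measurable_ckernel x gi fi.
have E t : ckernel f g x t = ckernel g f x (x - t).
  by rewrite /ckernel subKr mulrC.
rewrite /cintegral /Rintegral; congr (fine _ +i* fine _).
  rewrite -[RHS](integral_reflect_at x); last exact/measurable_EFinP.
  by apply: eq_integral => t _; rewrite E.
rewrite -[RHS](integral_reflect_at x); last exact/measurable_EFinP.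
by apply: eq_integral => t _; rewrite E.
Qed.

Lemma convolution_lin (a : R[i]) f f' g x : cint f -> cint f' -> cint g -> 0 <= x <= 1 ->
  cintegrable mu setT (ckernel f g x) -> cintegrable mu setT (ckernel f' g x) ->
  convolution (fun t => a * f t + f' t) g x = a * convolution f g x + convolution f' g x.
Proof.
move=> fi f'i gi x01 k k'; rewrite !convolutionE// -cintegral_lin//.
congr cintegral; apply/funext => t; rewrite /ckernel /cut01 /cut; case: ifP => _; ring.
Qed.

(** The modulus of the convolution is bounded by the convolution of the moduli,
    whose integral over [0,1] is at most its integral over the line. *)
Lemma convolution_norm f g : cint f -> cint g ->
  \int[mu]_(x in I01) Normc.normc (convolution f g x) <=
  \int[mu]_(x in I01) Normc.normc (f x) * \int[mu]_(x in I01) Normc.normc (g x).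
Proof.
move=> fi gi; have ci := cint_convolution fi gi.
rewrite -lee_fin -integral_econv_abs_cut//.
rewrite /Rintegral fineK; last first.
  by apply: integrable_fin_num => //; exact: integrable_normc.
have mE : measurable_fun setT (econv (abs_cut f) (abs_cut g)).
  by apply: measurable_econv => //; exact: measurable_abs_cut.
apply: (@le_trans _ _ (\int[mu]_(x in I01) econv (abs_cut f) (abs_cut g) x)%E).
  apply: ae_ge0_le_integral => //.
  - by move=> x _; rewrite lee_fin normc_ge0.
  - by apply/measurable_EFinP/cmeasurable_normc/(cintegrable_measurable ci).
  - by move=> x _; exact: econv_ge0.
  - exact: measurable_funTS.
  have := ae_cintegrable_ckernel fi gi; apply: filterS => x ki xI.
  have x01 : 0 <= x <= 1 by move: xI; rewrite /= in_itv.
  rewrite convolutionE// econv_abs_cut.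
  have := normc_cintegral measurableT ki; rewrite -lee_fin => /le_trans; apply.
  rewrite /Rintegral fineK//.
  by apply: integrable_fin_num => //; exact: integrable_normc.
by apply: ge0_subset_integral => // x _; exact: econv_ge0.
Qed.

Lemma convolutionJ f g x : 0 <= x <= 1 -> cintegrable mu setT (ckernel f g x) ->
  convolution (fun t => (f t)^*) (fun t => (g t)^*) x = (convolution f g x)^*.
Proof.
move=> x01 ki; rewrite !convolutionE// -cintegralJ//.
congr cintegral; apply/funext => t; rewrite /ckernel /cut01 /cut.
by case: ifP; case: ifP; rewrite ?(mulr0, mul0r) ?rmorphM ?rmorph0.
Qed.

(** Multiplication by the real character exp (l t) of the additive group of the
    line; being multiplicative in t, it commutes with convolution. *)
Definition dilation (l : R) f : LR -> R[i] := fun t => (expR (l * t))%:C * f t.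

Lemma cint_dilation l f : cint f -> cint (dilation l f).
Proof.
move=> fi; have := integrable_normc mI01 fi => ni.
apply: (cintegrable_le mI01 (g := fun t => expR `|l| * Normc.normc (f t))).
- apply: cmeasurableM; last exact: cintegrable_measurable fi.
  split => /=; last exact: measurable_cst.
  by apply: measurable_funTS; apply: measurableT_comp => //; exact: measurable_funM.
- by have := integrableZl mI01 (expR `|l|) ni; exact: eq_integrable.
move=> t; rewrite /= in_itv/= => /andP[t0 t1].
rewrite /dilation Normc.normcM ler_wpM2r ?normc_ge0//.
rewrite normcR ger0_norm ?expR_ge0// ler_expR.
apply: le_trans (ler_norm _) _; rewrite normrM (ger0_norm t0).
by rewrite ler_piMr.
Qed.

(** exp (l x) = exp (l (x - t)) exp (l t) is a constant factor under the integral
    in t. *)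
Lemma convolution_dilation l f g x : 0 <= x <= 1 -> cintegrable mu setT (ckernel f g x) ->
  convolution (dilation l f) (dilation l g) x = dilation l (convolution f g) x.
Proof.
move=> x01 ki; rewrite /dilation !convolutionE// -cintegralZ//.
congr cintegral; apply/funext => t; rewrite /ckernel /cut01 /cut.
have -> : l * x = l * (x - t) + l * t by ring.
by rewrite expRD rmorphM/=; do 2 case: ifP => _; ring.
Qed.

End Convolution.

Section NonnegConvolution.
Context (R : realType).
Local Notation mu := (@lebesgue_measure R).
Local Notation LR := (measurableTypeR R).
Local Notation I01 := (`[0, 1]%classic : set LR).
Local Notation cint f := (cintegrable mu I01 f).
Implicit Types f g h : LR -> R[i].

Definition nonneg01 f := forall x, 0 <= x <= 1 -> 0 <= f x.

Lemma ge0_normc (z : R[i]) : 0 <= z -> z = (Normc.normc z)%:C.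
Proof. by move=> z0; rewrite -[RHS]/(`|z|) ger0_norm. Qed.

Lemma ckernel_ge0 f g x t : nonneg01 f -> nonneg01 g -> 0 <= ckernel f g x t.
Proof.
move=> f0 g0; rewrite /ckernel /cut01 !cut_itvE.
by case: ifP => [/f0 ?|_]; case: ifP => [/g0 ?|_]; rewrite ?(mulr0, mul0r)// mulr_ge0.
Qed.

(** For nonnegative functions the complex integral is the [0,+oo]-valued one
    wherever the latter is finite; where it is infinite, both sides are 0, the
    value of [fine] at +oo. *)
Lemma nonneg_convolutionE f g x : nonneg01 f -> nonneg01 g -> 0 <= x <= 1 ->
  convolution f g x = (fine (econv (abs_cut f) (abs_cut g) x))%:C.
Proof.
move=> f0 g0 x01; rewrite convolutionE// econv_abs_cut /cintegral.
congr (fine _ +i* _).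
  by apply: eq_integral => t _ /=; rewrite {1}(ge0_normc (ckernel_ge0 x t f0 g0)).
rewrite (@eq_Rintegral _ _ _ mu setT (fun=> 0)).
  by rewrite /Rintegral integral0.
by move=> t _; rewrite (ge0_normc (ckernel_ge0 x t f0 g0)).
Qed.

Lemma nonneg_convolution f g : nonneg01 f -> nonneg01 g -> nonneg01 (convolution f g).
Proof.
move=> f0 g0 x x01; rewrite nonneg_convolutionE// lecR fine_ge0//.
by apply: econv_ge0 => t; exact: abs_cut_ge0.
Qed.

Lemma abs_cutE f t : abs_cut f t = if 0 <= t <= 1 then (Normc.normc (f t))%:E else 0%E.
Proof. by rewrite /abs_cut /cut01 cut_itvE; case: ifP => //; rewrite normcR normr0. Qed.

(** The convolution on [0,1] is cut off at 1, that on the line is not. At a point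
    x <= 1 only the values of the inner convolution on [0,x] matter, because
    [abs_cut h] vanishes at negative points. *)
Lemma econv_abs_convolution f g h x : cint f -> cint g -> cint h ->
  nonneg01 f -> nonneg01 g -> 0 <= x <= 1 ->
  econv (abs_cut h) (abs_cut (convolution f g)) x =
  econv (abs_cut h) (econv (abs_cut f) (abs_cut g)) x.
Proof.
move=> fi gi hi f0 g0 /andP[x0 x1].
have mh : measurable_fun setT (fun t : LR => abs_cut h (x - t)).
  exact: measurableT_comp (measurable_abs_cut hi) (measurable_reflect_at x).
apply: ae_eq_integral => //.
- apply: emeasurable_funM => //; apply: measurable_abs_cut; exact: cint_convolution.
- apply: emeasurable_funM => //; apply: measurable_econv; try exact: measurable_abs_cut;
    by move=> t; exact: abs_cut_ge0.
apply: filterS (ae_cintegrable_ckernel fi gi) => t ki _.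
rewrite [abs_cut (convolution f g) t]abs_cutE; case: ifP => [t01|/negP t01].
  congr *%E; rewrite nonneg_convolutionE// normcR ger0_norm; last first.
    by rewrite fine_ge0//; apply: econv_ge0 => s; exact: abs_cut_ge0.
  rewrite fineK// econv_abs_cut.
  by apply: integrable_fin_num => //; exact: integrable_normc.
rewrite mule0; apply/esym/eqP; rewrite mule_eq0; apply/orP.
have [t1|t1] := ltP 1 t.
  left; rewrite abs_cutE; case: ifP => // /andP[? ?]; exfalso; lra.
right; apply/eqP; rewrite /econv; apply: integral0_eq => s _.
rewrite !abs_cutE; case: ifP => [/andP[? ?]|_]; last by rewrite mul0e.
case: ifP => [/andP[? ?]|_]; last by rewrite mule0.
by exfalso; apply: t01; apply/andP; split; lra.
Qed.

Lemma nonneg_convolution_cycle f g h x : cint f -> cint g -> cint h ->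
  nonneg01 f -> nonneg01 g -> nonneg01 h -> 0 <= x <= 1 ->
  convolution h (convolution f g) x = convolution g (convolution h f) x.
Proof.
move=> fi gi hi f0 g0 h0 x01.
rewrite (nonneg_convolutionE h0 (nonneg_convolution f0 g0) x01).
rewrite (nonneg_convolutionE g0 (nonneg_convolution h0 f0) x01).
apply: (congr1 (fun z => (fine z)%:C)).
apply: (etrans (econv_abs_convolution fi gi hi f0 g0 x01)).
apply: (etrans _ (esym (econv_abs_convolution hi fi gi h0 f0 x01))).
by apply: econv_cycle; try exact: measurable_abs_cut; move=> t; exact: abs_cut_ge0.
Qed.
End NonnegConvolution.

(** * The convolution algebra of classes *)

Section L1Algebra.
Context (R : realType).
Local Notation mu := (@lebesgue_measure R).
Local Notation LR := (measurableTypeR R).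
Local Notation I01 := (`[0, 1]%classic : set LR).
Local Notation cint f := (cintegrable mu I01 f).
Local Notation fct := (R -> R[i]^o).
Implicit Types (f g h : fct) (u v w : L1 R).

Let mI01 : measurable I01. Proof. exact: measurable_I01. Qed.
Hint Resolve mI01 : core.

Lemma repr_cint u : cint (repr u : fct).
Proof. exact: l1fun_integrable. Qed.
Hint Resolve repr_cint : core.

Lemma l1_class_repr u : l1_class (repr u : fct) = u.
Proof. by rewrite l1_classE [LHS]reprK. Qed.

Lemma repr_ae f : cint f -> ae_eq mu I01 (repr (l1_class f) : fct) f.
Proof. by move=> fi; apply/l1_class_eq => //; rewrite l1_class_repr. Qed.

Lemma l1_class_eq_on f g : cint f -> (forall x, 0 <= x <= 1 -> f x = g x) ->
  l1_class f = l1_class g.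
Proof.
move=> fi fg; apply/l1_class_eq => //; first exact: eq_cint fi.
by apply: aeW => x; rewrite /= in_itv/= => /fg.
Qed.

Lemma l1_class_eq_ae f g : cint f -> cint g ->
  {ae mu, forall x, 0 <= x <= 1 -> f x = g x} -> l1_class f = l1_class g.
Proof.
move=> fi gi fg; apply/l1_class_eq => //; apply: filterS fg.
Qed.

Lemma l1_class_lin (a : R[i]) f g : cint f -> cint g ->
  l1_class (fun t => a * f t + g t) = a *: l1_class f + l1_class g.
Proof.
move=> fi gi.
have fp : f \in @l1fun_pred R by apply/asboolP.
have gp : g \in @l1fun_pred R by apply/asboolP.
rewrite -[f in RHS]/(L1Fun fp : fct) -[g in RHS]/(L1Fun gp : fct) !l1_classE.
rewrite [_ *: _]l1_piZ l1_piD -l1_classE; congr l1_class.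
Qed.

Lemma l1_mul_class f g : cint f -> cint g ->
  l1_mul (l1_class f) (l1_class g) = l1_class (convolution f g).
Proof.
move=> fi gi; apply: l1_class_eq_on; first exact: cint_convolution.
by move=> x x01; apply: convolution_ae => //; exact: repr_ae.
Qed.

Lemma l1_star_class f : cint f -> l1_star (l1_class f) = l1_class (fun x => (f x)^*).
Proof.
move=> fi; apply/l1_class_eq; try exact: cintegrableJ.
by apply: filterS (repr_ae fi) => x h xI; rewrite h.
Qed.

Lemma l1_norm_class f : cint f ->
  `|l1_class f| = (\int[mu]_(t in I01) Normc.normc (f t))%:C.
Proof. exact: l1_class_norm. Qed.

(** Every class is a complex combination of four classes of nonnegative
    functions, the positive and negative parts of the real and imaginary parts.
    Hence a multilinear identity only has to be checked on nonnegative functions. *)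
Lemma l1_ind (P : L1 R -> Prop) :
  (forall (a : R[i]) u v, P u -> P v -> P (a *: u + v)) ->
  (forall f, cint f -> nonneg01 f -> P (l1_class f)) -> forall u, P u.
Proof.
move=> Plin P0 u; have [f [fr fi] ->] := l1_class_surj u.
have pos (p : LR -> R) : mu.-integrable I01 (EFin \o p) ->
    cint (fun t => (Num.max (p t) 0)%:C) /\ P (l1_class (fun t => (Num.max (p t) 0)%:C)).
  move=> pii.
  have ci : cint (fun t => (Num.max (p t) 0)%:C).
    split => /=; last exact: integrable0.
    have := integrable_funepos mI01 pii; apply: eq_integrable => // t _.
    by rewrite /= funeposE/= -EFin_max.
  split=> //; apply: P0 => // x _; by rewrite lecR le_max lexx orbT.
have [r1 P1] := pos _ fr.
have [r2 P2] := pos (fun t => - complex.Re (f t)) (integrableN fr).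
have [i1 P3] := pos _ fi.
have [i2 P4] := pos (fun t => - complex.Im (f t)) (integrableN fi).
have {}P2 := Plin (- 1) _ _ P2 P1; rewrite -l1_class_lin// in P2.
have c2 := cintegrable_lin mI01 (- 1) r2 r1.
have {}P4 := Plin (- 'i%C) _ _ P4 P2; rewrite -l1_class_lin// in P4.
have c4 := cintegrable_lin mI01 (- 'i%C) i2 c2.
have := Plin 'i _ _ P3 P4; rewrite -l1_class_lin//.
congr (P (l1_class _)); apply/funext => t.
have mx (r : R) : Num.max r 0 - Num.max (- r) 0 = r.
  by case: (leP r 0); case: (leP (- r) 0); lra.
have := mx (complex.Re (f t)); have := mx (complex.Im (f t)).
move: (Num.max _ 0) (Num.max _ 0) (Num.max _ 0) (Num.max _ 0) => m1 m2 m3 m4 mi mr.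
by apply/eqP; rewrite eq_complex/=; apply/andP; split; apply/eqP; lra.
Qed.

Lemma l1_mul_linearl w : linear (fun u => l1_mul u w).
Proof.
move=> a u v.
rewrite -[u]l1_class_repr -[v]l1_class_repr -[w]l1_class_repr.
move: (repr u : fct) (repr v : fct) (repr w : fct) (repr_cint u) (repr_cint v) (repr_cint w).
move=> {}u {}v {}w ui vi wi.
rewrite -l1_class_lin// !l1_mul_class//; last exact: cintegrable_lin.
rewrite -l1_class_lin//; try exact: cint_convolution.
apply: l1_class_eq_ae.
- by apply: cint_convolution => //; exact: cintegrable_lin.
- by apply: cintegrable_lin => //; exact: cint_convolution.
apply: (ae_imply2 (ae_cintegrable_ckernel ui wi) (ae_cintegrable_ckernel vi wi)) => x k1 k2 x01.
exact: convolution_lin.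
Qed.

Lemma l1_mulC : commutative (@l1_mul R).
Proof.
move=> u v; rewrite -[u]l1_class_repr -[v]l1_class_repr !l1_mul_class//.
apply: l1_class_eq_on; first exact: cint_convolution.
by move=> x x01; exact: convolutionC.
Qed.

Lemma l1_mul_linearr w : linear (l1_mul w).
Proof. by move=> a u v; rewrite l1_mulC l1_mul_linearl !(l1_mulC w). Qed.

(** Both sides are trilinear, so nonnegative functions suffice. *)
Lemma l1_mul_cycle u v w :
  l1_mul w (l1_mul u v) = l1_mul v (l1_mul w u).
Proof.
move: u; apply: l1_ind => [a u u'|f fi f0].
  by move=> e1 e2; rewrite l1_mul_linearl !l1_mul_linearr e1 e2.
move: v; apply: l1_ind => [a u u'|g gi g0].
  by move=> e1 e2; rewrite !(l1_mul_linearl, l1_mul_linearr) e1 e2.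
move: w; apply: l1_ind => [a u u'|h hi h0].
  by move=> e1 e2; rewrite !(l1_mul_linearl, l1_mul_linearr) e1 e2.
have fgi := cint_convolution fi gi; have hfi := cint_convolution hi fi.
rewrite (l1_mul_class fi gi) (l1_mul_class hi fgi) (l1_mul_class hi fi) (l1_mul_class gi hfi).
apply: (l1_class_eq_on (cint_convolution hi fgi)) => x x01.
exact: nonneg_convolution_cycle.
Qed.

Lemma l1_mulA : associative (@l1_mul R).
Proof.
by move=> u v w; rewrite (l1_mulC (l1_mul u v) w) (l1_mul_cycle u v w) (l1_mul_cycle w u v). Qed.

Lemma l1_normM u v : `|l1_mul u v| <= `|u| * `|v|.
Proof.
rewrite -[u]l1_class_repr -[v]l1_class_repr l1_mul_class// !l1_norm_class//.
  by rewrite -rmorphM lecR; exact: convolution_norm.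
exact: cint_convolution.
Qed.

Lemma l1_star_semilinear (a : R[i]) u v : l1_star (a *: u + v) = a^* *: l1_star u + l1_star v.
Proof.
rewrite -[u]l1_class_repr -[v]l1_class_repr -l1_class_lin//.
rewrite !l1_star_class//; last exact: cintegrable_lin.
rewrite -l1_class_lin; [|exact: cintegrableJ..].
congr l1_class; apply/funext => x; by rewrite rmorphD rmorphM.
Qed.

Lemma l1_starK : involutive (@l1_star R).
Proof.
move=> u; rewrite -[u]l1_class_repr !l1_star_class//; last exact: cintegrableJ.
by congr l1_class; apply/funext => x; rewrite conjcK.
Qed.

Lemma l1_norm_star u : `|l1_star u| = `|u|.
Proof.
rewrite -[u]l1_class_repr l1_star_class// !l1_norm_class//; last exact: cintegrableJ.
by congr _%:C; apply: eq_Rintegral => x _; rewrite normcJ.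
Qed.

Lemma l1_starM u v : l1_star (l1_mul u v) = l1_mul (l1_star v) (l1_star u).
Proof.
rewrite l1_mulC -[u]l1_class_repr -[v]l1_class_repr.
have ui := repr_cint u; have vi := repr_cint v.
rewrite (l1_star_class ui) (l1_star_class vi) (l1_mul_class vi ui).
rewrite (l1_mul_class (cintegrableJ mI01 vi) (cintegrableJ mI01 ui)).
rewrite (l1_star_class (cint_convolution vi ui)).
apply: l1_class_eq_ae.
- exact (cintegrableJ mI01 (cint_convolution vi ui)).
- exact (cint_convolution (cintegrableJ mI01 vi) (cintegrableJ mI01 ui)).
have ae := ae_cintegrable_ckernel vi ui.
by apply: filterS ae => x k x01; rewrite (convolutionJ x01 k).
Qed.

Definition l1_dilation (l : R) u : L1 R := l1_class (dilation l (repr u : fct)).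

Lemma l1_dilation_class l f : cint f -> l1_dilation l (l1_class f) = l1_class (dilation l f).
Proof.
move=> fi; apply/l1_class_eq; try exact: cint_dilation.
by apply: filterS (repr_ae fi) => x h xI; rewrite /dilation h.
Qed.

Lemma l1_dilationM l u v : l1_dilation l (l1_mul u v) = l1_mul (l1_dilation l u) (l1_dilation l v).
Proof.
rewrite -[u]l1_class_repr -[v]l1_class_repr.
have ui := repr_cint u; have vi := repr_cint v.
rewrite (l1_mul_class ui vi) (l1_dilation_class l (cint_convolution ui vi)).
rewrite (l1_dilation_class l ui) (l1_dilation_class l vi).
rewrite (l1_mul_class (cint_dilation l ui) (cint_dilation l vi)).
apply: l1_class_eq_ae.
- exact: cint_dilation (cint_convolution ui vi).
- exact: cint_convolution (cint_dilation l ui) (cint_dilation l vi).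
have ae := ae_cintegrable_ckernel (repr_cint u) (repr_cint v).
by apply: filterS ae => x k x01; rewrite (convolution_dilation l x01 k).
Qed.

Lemma l1_dilation_linear l : linear (l1_dilation l).
Proof.
move=> a u v; rewrite -[u]l1_class_repr -[v]l1_class_repr -l1_class_lin//.
rewrite !l1_dilation_class//; last exact: cintegrable_lin.
rewrite -l1_class_lin; [|exact: cint_dilation..].
by congr l1_class; apply/funext => x; rewrite /dilation; ring.
Qed.

Lemma l1_dilation_star l u : l1_dilation l (l1_star u) = l1_star (l1_dilation l u).
Proof.
rewrite -[u]l1_class_repr l1_star_class// !l1_dilation_class//; last exact: cintegrableJ.
rewrite l1_star_class; last exact: cint_dilation.
by congr l1_class; apply/funext => x; rewrite /dilation/=; case: (repr u x : R[i]) => a b;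
  apply/eqP; rewrite eq_complex/=; apply/andP; split; apply/eqP; ring.
Qed.

Lemma l1_dilationK l : cancel (l1_dilation (- l)) (l1_dilation l).
Proof.
move=> u; rewrite -[u]l1_class_repr !l1_dilation_class//; last exact: cint_dilation.
congr l1_class; apply/funext => x; rewrite /dilation mulrA -rmorphM/= -expRD.
by rewrite mulNr subrr expR0 mul1r.
Qed.

(** Dominated convergence: exp (- n t) tends to 0 for t > 0 and is at most 1. *)
Lemma l1_dilation_norm_cvg u :
  (fun n => complex.Re `|l1_dilation (- n%:R) u|) @ \oo --> (0 : R).
Proof.
rewrite -[u]l1_class_repr; set f := (repr u : fct); have fi : cint f by exact: repr_cint.
rewrite (_ : (fun n => _) = (fun n : nat =>
  \int[mu]_(t in I01) (expR (- n%:R * t) * Normc.normc (f t)))); last first.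
  apply/funext => n; rewrite l1_dilation_class// l1_norm_class//; last exact: cint_dilation.
  apply: eq_Rintegral => t _; rewrite /dilation Normc.normcM normcR ger0_norm ?expR_ge0//.
have ni := integrable_normc mI01 fi.
have mn n : measurable_fun I01 (fun t : LR => expR (- n%:R * t) * Normc.normc (f t)).
  apply: measurable_funM.
    by apply: measurable_funTS; apply: measurableT_comp => //; exact: measurable_funM.
  exact: cmeasurable_normc (cintegrable_measurable fi).
have := @dominated_convergence _ _ _ mu I01 mI01
  (fun n t => (expR (- n%:R * t) * Normc.normc (f t))%:E) (cst 0%E)
  (fun t => (Normc.normc (f t))%:E).
case.
- by move=> n; apply/measurable_EFinP.
- exact: measurable_cst.
(* pointwise convergence fails only at t = 0 *)
- exists [set 0]; split.
  + exact: measurable_set1.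
  + exact: lebesgue_measure_set1.
  move=> t /= nt; apply/eqP; apply: contrapT => /negP t0; apply: nt.
  rewrite in_itv/= => /andP[tge0 _]; apply: cvg_EFin; first exact: nearW.
  rewrite [X in X @ _](_ : _ = geometric (Normc.normc (f t)) (expR (- t))).
    by apply: cvg_geometric; rewrite ger0_norm ?expR_ge0// expR_lt1 oppr_lt0 lt_def t0.
  by apply/funext => n /=; rewrite mulNr -mulrN expRM_natl mulrC.
- exact: ni.
- apply: aeW => t n; rewrite /= in_itv/= => /andP[t0 _]; rewrite lee_fin.
  rewrite normrM (ger0_norm (normc_ge0 _)) ler_piMl ?normc_ge0//.
  by rewrite ger0_norm ?expR_ge0// expR_le1 mulNr oppr_le0 mulr_ge0.
by move=> _ _; rewrite integral0 => /fine_cvg.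
Qed.

(** Integration is the continuous functional that no combination of positive
    functionals equals. It also recovers c from the class of the constant
    function c. *)
Definition l1_int u : R[i] := cintegral mu I01 (repr u : fct).

Lemma l1_int_class f : cint f -> l1_int (l1_class f) = cintegral mu I01 f.
Proof.
move=> fi; exact (ae_eq_cintegral mI01 (cintegrable_measurable (repr_cint _))
  (cintegrable_measurable fi) (repr_ae fi)).
Qed.

Lemma l1_int_lin (a : R[i]) u v : l1_int (a *: u + v) = a * l1_int u + l1_int v.
Proof.
rewrite -[u]l1_class_repr -[v]l1_class_repr -l1_class_lin//.
by rewrite !l1_int_class ?cintegral_lin//; exact: cintegrable_lin.
Qed.

Lemma normr_l1_int u : `|l1_int u| <= `|u|.
Proof.
rewrite -[u]l1_class_repr l1_int_class// l1_norm_class//.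
by rewrite [leLHS]/((Normc.normc _)%:C) lecR; exact: normc_cintegral.
Qed.

Lemma cint_cst (c : R[i]) : cint (fun=> c).
Proof.
have h (r : R) : mu.-integrable I01 (EFin \o (fun=> r)).
  apply/integrableP; split; first exact: measurable_cst.
  by rewrite integral_cst//= lebesgue_measure_itv/= lte_fin ltr01 oppr0 adde0 mule1 ltry.
by split; [exact: h (complex.Re c)|exact: h (complex.Im c)].
Qed.

Lemma Rintegral01_cst (r : R) : \int[mu]_(t in I01) r = r.
Proof.
transitivity (r * fine (mu I01)); first exact: Rintegral_cst.
by rewrite [mu _]lebesgue_measure_itv/= lte_fin ltr01 oppr0 adde0 mulr1.
Qed.

Lemma l1_int_cst (c : R[i]) : l1_int (l1_class (fun=> c)) = c.
Proof.
rewrite l1_int_class; last exact: cint_cst.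
by rewrite /cintegral !Rintegral01_cst; case: c.
Qed.

Lemma l1_norm_cst (c : R[i]) : `|l1_class (fun=> c) : L1 R| = `|c|.
Proof.
rewrite l1_norm_class; last exact: cint_cst.
by rewrite Rintegral01_cst.
Qed.
End L1Algebra.

(** * Completeness along sequences *)

Section RealNorm.
Context (R : realType) (V : normedModType R[i]).
Implicit Types (x y : V) (u : nat -> V).

(** Norms of spaces over R[i] take their values in R[i]; this is the same norm as
    a real number, to which linear arithmetic applies. *)
Definition rnorm x : R := complex.Re `|x|.

Lemma rnormE x : `|x| = (rnorm x)%:C.
Proof.
rewrite /rnorm; have := normr_ge0 x; case: `|x| => a b.
by rewrite lecE/= => /andP[/eqP -> _].
Qed.

Lemma rnorm_ge0 x : 0 <= rnorm x.
Proof. by have := normr_ge0 x; rewrite rnormE lecR. Qed.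

Lemma rnorm0 : rnorm 0 = 0.
Proof. by rewrite /rnorm normr0. Qed.

Lemma rnormBC x y : rnorm (x - y) = rnorm (y - x).
Proof. by rewrite /rnorm distrC. Qed.

Lemma rnormD x y : rnorm (x + y) <= rnorm x + rnorm y.
Proof. by have := ler_normD x y; rewrite !rnormE -rmorphD lecR. Qed.

Lemma rnorm_triangle y x z : rnorm (x - z) <= rnorm (x - y) + rnorm (y - z).
Proof. by rewrite -{1}(subrK y x) -addrA rnormD. Qed.

Lemma rnormZ (a : R[i]) x : rnorm (a *: x) = Normc.normc a * rnorm x.
Proof. by rewrite /rnorm normrZ [`|x|]rnormE/= mul0r subr0. Qed.

Lemma rnorm_eq0 x : rnorm x = 0 -> x = 0.
Proof. by move=> x0; apply/eqP; rewrite -normr_eq0 rnormE x0. Qed.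

Definition seq_cvg u (l : V) := forall eps : R, 0 < eps ->
  exists N, forall n, (N <= n)%N -> rnorm (u n - l) < eps.

Definition seq_cauchy u := forall eps : R, 0 < eps ->
  exists N, forall m n, (N <= m)%N -> (N <= n)%N -> rnorm (u m - u n) < eps.

(** The completeness clause of [is_banach_star_algebra]. *)
Definition filter_complete := forall F : set_system V, ProperFilter F -> cauchy F -> cvg F.

Lemma half_expn_small (eps : R) : 0 < eps -> exists N, forall n, (N <= n)%N -> 2^-1 ^+ n < eps.
Proof.
move=> e0; have : (fun n => 2^-1 ^+ n : R) @ \oo --> (0 : R).
  by apply: cvg_expr; rewrite ger0_norm ?invr_ge0// invf_lt1// ltr1n.
move=> /cvgrPdist_lt/(_ _ e0)[N _ h]; exists N => n /h/=.
by rewrite sub0r normrN ger0_norm// exprn_ge0// invr_ge0.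
Qed.

Lemma pos_complex (e : R[i]) : 0 < e -> exists2 r : R, 0 < r & e = r%:C.
Proof.
by case: e => a b; rewrite ltcE/= => /andP[/eqP -> a0]; exists a.
Qed.

(** A Cauchy filter contains balls of radius 2^-(n+2) around suitable points u n.
    Two members of a proper filter meet, so the sequence u is fast, and its limit
    is the limit of the filter. *)
Lemma fast_filter_complete :
  (forall u, (forall n, rnorm (u n.+1 - u n) <= 2^-1 ^+ n) -> exists l, seq_cvg u l) ->
  filter_complete.
Proof.
move=> H F FF /cauchyP cF.
have h2 n : (0 : R) < 2^-1 ^+ n by rewrite exprn_gt0// invr_gt0.
have /boolp.choice[u Hu] (n : nat) : exists x, F (ball x ((2^-1 ^+ n.+2)%:C : R[i])).
  by apply: cF; rewrite ltcR.
have uF n (P : V -> Prop) : F P -> exists2 y, P y & rnorm (u n - y) < 2^-1 ^+ n.+2.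
  move=> FP; have [y [Py]] := filter_ex (filterI FP (Hu n)).
  by rewrite -ball_normE /ball_/= rnormE ltcR => ?; exists y.
have [] := H u.
  move=> n; have [y + uy] := uF n _ (Hu n.+1).
  rewrite -ball_normE /ball_/= rnormE ltcR => uy'.
  have := rnorm_triangle y (u n.+1) (u n); rewrite (rnormBC y).
  move: (h2 n) uy uy'; rewrite !exprS; lra.
move=> l ul; apply/cvg_ex; exists l; apply/cvgrPdist_lt => e /pos_complex[r r0 ->].
have [N1 h1] := ul _ (divr_gt0 r0 (ltr0n R 2)).
have [N2 h3] := half_expn_small (divr_gt0 r0 (ltr0n R 2)).
pose N := maxn N1 N2.
apply: filterS (Hu N) => y; rewrite -ball_normE /ball_/= !rnormE !ltcR => uy.
have := h1 N (leq_maxl _ _); have := h3 N (leq_maxr _ _).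
have := rnorm_triangle (u N) l y; rewrite (rnormBC l (u N)).
move: (h2 N) uy; rewrite !exprS; lra.
Qed.

Lemma geometric_seq_cauchy u (c : R) : 0 <= c ->
  (forall n, rnorm (u n.+1 - u n) <= c * 2^-1 ^+ n) -> seq_cauchy u.
Proof.
move=> c0 step.
have h2 n : (0 : R) < 2^-1 ^+ n by rewrite exprn_gt0// invr_gt0.
have dist n m : rnorm (u (n + m)%N - u n) <= c * 2^-1 ^+ n * (2 - 2 * 2^-1 ^+ m).
  elim: m => [|m IHm].
    by rewrite addn0 subrr rnorm0 expr0 mulr1 subrr mulr0.
  have := rnorm_triangle (u (n + m)%N) (u (n + m.+1)%N) (u n).
  by have := step (n + m)%N; rewrite addnS exprD exprS mulrA; lra.
have dist' n m : (n <= m)%N -> rnorm (u m - u n) <= 2 * c * 2^-1 ^+ n.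
  move=> nm; have := dist n (m - n)%N; rewrite subnKC//.
  have : 0 <= c * 2^-1 ^+ n * 2^-1 ^+ (m - n) by rewrite !mulr_ge0// ltW.
  lra.
move=> e e0; have d0 : 0 < e / (4 * c + 1) by rewrite divr_gt0//; lra.
have [N h] := half_expn_small d0; exists N => m n Nm Nn.
have := rnorm_triangle (u N) (u m) (u n); rewrite (rnormBC (u N)).
have := dist' _ _ Nm; have := dist' _ _ Nn.
have := h N (leqnn _); rewrite ltr_pdivlMr; last lra.
move: (h2 N); lra.
Qed.

Hypothesis complete : filter_complete.

Lemma seq_cauchy_cvg u : seq_cauchy u -> exists l, seq_cvg u l.
Proof.
move=> cu; have : cvg (u @ \oo).
  apply: complete; apply/cauchyP => e /pos_complex[r r0 ->].
  have [N h] := cu _ r0; exists (u N); exists N => // n /= Nn.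
  by rewrite -ball_normE /ball_/= rnormE ltcR h.
move=> /cvg_ex[l /cvgrPdist_lt ul]; exists l => e e0.
have [|N _ h] := ul e%:C; first by rewrite ltcR.
by exists N => n /h/=; rewrite rnormE ltcR rnormBC.
Qed.

(** Banach's fixed point theorem in a subset closed under limits of sequences. The
    ratio 1/2 is enough here, since the dilations make all the elements to which
    it is applied small. *)
Lemma half_contraction_fixpoint (P : V -> Prop) (F : V -> V) (x0 : V) :
  P x0 -> (forall x, P x -> P (F x)) ->
  (forall u l, (forall n, P (u n)) -> seq_cvg u l -> P l) ->
  (forall x y, P x -> P y -> rnorm (F x - F y) <= 2^-1 * rnorm (x - y)) ->
  exists2 p, P p & F p = p.
Proof.
move=> P0 PF Pcl ctr; pose u n := iter n F x0; pose c := rnorm (u 1%N - u 0%N).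
have Pu n : P (u n) by elim: n => //= n; exact: PF.
have c0 : 0 <= c by exact: rnorm_ge0.
have step n : rnorm (u n.+1 - u n) <= c * 2^-1 ^+ n.
  elim: n => [|n IHn]; first by rewrite mulr1.
  by apply: le_trans (ctr _ _ (Pu n.+1) (Pu n)) _; rewrite exprS; lra.
have [l ul] := seq_cauchy_cvg (geometric_seq_cauchy c0 step).
have Pl := Pcl _ _ Pu ul; exists l => //.
apply/eqP; rewrite -subr_eq0; apply/eqP/rnorm_eq0.
apply/le_anti; rewrite rnorm_ge0 andbT; apply/ler_addgt0Pl => e e0; rewrite addr0.
have [N h] := ul _ (divr_gt0 e0 (ltr0n R 2)).
have := rnorm_triangle (u N.+1) (F l) l.
have := ctr _ _ Pl (Pu N); rewrite -[F (u N)]/(u N.+1) (rnormBC l).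
have := h N (leqnn _); have := h N.+1 (leqnSn _); have := rnorm_ge0 (u N - l).
lra.
Qed.

End RealNorm.

(** * Completeness of the convolution algebra *)

Section DominatedIncrements.
Context d (T : measurableType d) (R : realType).
Variables (mu : {measure set T -> \bar R}) (D : set T).
Hypothesis mD : measurable D.

(** The integrals of the terms are bounded by a geometric series of sum 2. *)
Lemma integrable_half_series (h : nat -> T -> R) :
  (forall n, mu.-integrable D (EFin \o h n)) ->
  (forall n t, 0 <= h n t) ->
  (forall n, \int[mu]_(t in D) h n t <= 2^-1 ^+ n) ->
  mu.-integrable D (fun t => \sum_(0 <= k <oo) (h k t)%:E)%E.
Proof.
move=> hi h0 hle.
have mh n : measurable_fun D (EFin \o h n) by exact: measurable_int (hi n).
apply/integrableP; split.
  apply: ge0_emeasurable_sum => [k t ? ?|k ?]; last exact: mh.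
  by rewrite lee_fin.
under eq_integral do (rewrite gee0_abs; last by apply: nneseries_ge0 => k _ _; rewrite lee_fin).
rewrite integral_nneseries//; last by move=> n t _; rewrite lee_fin.
apply: (@le_lt_trans _ _ (2%:E)); last exact: ltry.
apply: lime_le.
  by apply: is_cvg_nneseries => n _ _; apply: integral_ge0 => t _; rewrite lee_fin.
apply: nearW => n.
apply: (@le_trans _ _ (\sum_(0 <= k < n) (2^-1 ^+ k)%:E)%E).
  apply: lee_sum => k _; rewrite -(fineK (integrable_fin_num mD (hi k))) lee_fin.
  exact: hle.
rewrite sumEFin lee_fin.
have -> : \sum_(0 <= k < n) 2^-1 ^+ k = 2 - 2 * 2^-1 ^+ n :> R.
  elim: n => [|n IHn]; first by rewrite big_nil expr0 mulr1 subrr.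
  by rewrite big_nat_recr//= IHn exprS; lra.
by rewrite gerBl mulr_ge0// exprn_ge0// invr_ge0.
Qed.

(** Where the dominating series is finite, that is almost everywhere, the sequence
    has absolutely summable increments, hence converges; all its terms are
    dominated by |p 0| plus the series, so dominated convergence applies. The
    limit is defined as a limit superior in order to be measurable everywhere. *)
Lemma dominated_increments_cvg (p h : nat -> T -> R) :
  (forall n, mu.-integrable D (EFin \o p n)) ->
  (forall n t, `|p n.+1 t - p n t| <= h n t) ->
  mu.-integrable D (fun t => \sum_(0 <= k <oo) (h k t)%:E)%E ->
  exists2 q : T -> R, mu.-integrable D (EFin \o q) &
    (fun n => \int[mu]_(t in D) `|p n t - q t|) @ \oo --> (0 : R).
Proof.
move=> ip hp iH.
have h0 n t : 0 <= h n t by apply: le_trans (hp n t).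
pose q t := fine (limn_esup (fun n => (p n t)%:E)).
have mq : measurable_fun D q.
  apply: measurableT_comp => //.
  by apply: (measurable_fun_limn_esup (f := fun n t => (p n t)%:E)) => n; exact: measurable_int (ip n).
have := @dominated_convergence _ _ _ mu D mD (fun n t => (p n t)%:E) (EFin \o q)
  (fun t => (`|p 0%N t|%:E + \sum_(0 <= k <oo) (h k t)%:E)%E).
have partial n t : `|p n t| <= `|p 0%N t| + \sum_(0 <= k < n) h k t.
  elim: n => [|n IHn]; first by rewrite big_nil addr0.
  rewrite big_nat_recr//= addrA; apply: le_trans (lerD IHn (hp n t)).
  by rewrite -{1}(subrK (p n t) (p n.+1 t)) addrC ler_normD.
case.
- by move=> n; exact: measurable_int (ip n).
- exact/measurable_EFinP.
- have := integrable_ae mD iH; apply: filterS => t Ht Dt.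
  have cv : cvgn (p ^~ t).
    rewrite (_ : p ^~ t = fun n => p 0%N t + series (telescope (p ^~ t)) n); last first.
      by apply/funext => n; rewrite -eq_sum_telescope.
    apply: is_cvgD; first exact: is_cvg_cst.
    apply: normed_cvg.
    apply: (@series_le_cvg _ _ (h ^~ t)) => [n|n|n|]; [exact: normr_ge0|exact: h0|exact: hp|].
    apply/cvg_ex; exists (fine (\sum_(0 <= k <oo) (h k t)%:E)%E).
    have ec : (\sum_(0 <= k < n) (h k t)%:E)%E @[n --> \oo] --> (\sum_(0 <= k <oo) (h k t)%:E)%E.
      by apply: is_cvg_nneseries => k _ _; rewrite lee_fin.
    rewrite -(fineK (Ht Dt)) in ec; have := fine_cvg ec.
    rewrite (_ : fine \o _ = series (h ^~ t)) => [c|]; first exact: c.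
    by apply/funext => n /=; rewrite sumEFin.
  have ec : (fun n => (p n t)%:E) @ \oo --> (limn (p ^~ t))%:E.
    by apply: cvg_EFin; [exact: nearW|exact: cv].
  rewrite /= /q is_cvg_limn_esupE; last by apply/cvg_ex; eexists; exact: ec.
  by rewrite (cvg_lim _ ec).
- apply: integrableD => //; exact: integrable_norm (ip 0%N).
- apply: aeW => t n Dt; rewrite /=.
  apply: (@le_trans _ _ (`|p 0%N t| + \sum_(0 <= k < n) h k t)%:E); first by rewrite lee_fin.
  rewrite EFinD leeD2l// -sumEFin; apply: nneseries_lim_ge => k _ _.
  by rewrite lee_fin.
move=> iq c0 _; exists q => //.
exact: (fine_cvg c0).
Qed.
End DominatedIncrements.

Section L1Complete.
Context (R : realType).
Local Notation mu := (@lebesgue_measure R).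
Local Notation LR := (measurableTypeR R).
Local Notation I01 := (`[0, 1]%classic : set LR).
Local Notation cint f := (cintegrable mu I01 f).
Local Notation fct := (R -> R[i]^o).

Let mI01 : measurable I01. Proof. exact: measurable_I01. Qed.
Hint Resolve mI01 : core.

Lemma rnorm_class (f : fct) : cint f ->
  rnorm (l1_class f) = \int[mu]_(t in I01) Normc.normc (f t).
Proof. by move=> fi; rewrite /rnorm l1_norm_class. Qed.

Lemma l1_class_sub (f g : fct) : cint f -> cint g ->
  l1_class (fun t => f t - g t) = l1_class f - l1_class g.
Proof.
move=> fi gi; rewrite -scaleN1r addrC -l1_class_lin//; congr l1_class.
by apply/funext => t; rewrite mulN1r addrC.
Qed.

Lemma cint_sub (f g : fct) : cint f -> cint g -> cint (fun t => f t - g t).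
Proof.
move=> fi gi; have := cintegrable_lin mI01 (- 1) gi fi.
by congr cintegrable; apply/funext => t; rewrite mulN1r addrC.
Qed.

Lemma normc_le_ReIm (z : R[i]) : Normc.normc z <= `|complex.Re z| + `|complex.Im z|.
Proof.
case: z => a b /=; rewrite -[leRHS]ger0_norm ?addr_ge0// -sqrtr_sqr ler_wsqrtr//.
by rewrite sqrrD !real_normK ?num_real// addrAC lerDl mulrn_wge0// mulr_ge0.
Qed.

(** Riesz-Fischer, for the real and imaginary parts of representatives of a fast
    sequence. *)
Lemma L1_complete : filter_complete (L1 R).
Proof.
apply: fast_filter_complete => u du.
pose f n : fct := repr (u n).
have fi n : cint (f n) by exact: repr_cint.
have fE n : u n = l1_class (f n) by rewrite l1_class_repr.
pose h n t := Normc.normc (f n.+1 t - f n t).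
have hi : mu.-integrable I01 (fun t => \sum_(0 <= k <oo) (h k t)%:E)%E.
  apply: integrable_half_series => //.
  - by move=> n; apply: integrable_normc => //; exact: cint_sub.
  - by move=> n t; exact: normc_ge0.
  - move=> n; have := du n; rewrite !fE -l1_class_sub// rnorm_class//.
    exact: cint_sub.
have reB (z w : R[i]) : complex.Re z - complex.Re w = complex.Re (z - w) by case: z w => ? ? [].
have imB (z w : R[i]) : complex.Im z - complex.Im w = complex.Im (z - w) by case: z w => ? ? [].
have [||r ri rc] :=
    @dominated_increments_cvg _ _ _ mu I01 mI01 (fun n t => complex.Re (f n t)) h _ _ hi.
  by move=> n; have [] := fi n.
  by move=> n t; rewrite reB normc_Re.
have [||s si sc] :=
    @dominated_increments_cvg _ _ _ mu I01 mI01 (fun n t => complex.Im (f n t)) h _ _ hi.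
  by move=> n; have [] := fi n.
  by move=> n t; rewrite imB normc_Im.
pose g : fct := fun t => r t +i* s t.
have gi : cint g by [].
exists (l1_class g) => e e0.
have e2 : 0 < e / 2 by rewrite divr_gt0.
move/cvgrPdist_lt : rc => /(_ _ e2)[N1 _ h1].
move/cvgrPdist_lt : sc => /(_ _ e2)[N2 _ h2].
exists (maxn N1 N2) => n; rewrite geq_max => /andP[n1 n2].
have := h1 n n1; have := h2 n n2; rewrite /= !sub0r !normrN => H2 H1.
rewrite fE -l1_class_sub// rnorm_class; last exact: cint_sub.
have [dr di] := cint_sub (fi n) gi.
have dr' : mu.-integrable I01 (EFin \o (fun t => `|complex.Re (f n t) - r t|)).
  have := integrable_norm dr; apply: eq_integrable => // t _.
  by rewrite /= -[r t]/(complex.Re (g t)) reB.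
have di' : mu.-integrable I01 (EFin \o (fun t => `|complex.Im (f n t) - s t|)).
  have := integrable_norm di; apply: eq_integrable => // t _.
  by rewrite /= -[s t]/(complex.Im (g t)) imB.
apply: (@le_lt_trans _ _ (\int[mu]_(t in I01) `|complex.Re (f n t) - r t| +
    \int[mu]_(t in I01) `|complex.Im (f n t) - s t|)).
  rewrite -RintegralD//; apply: le_Rintegral => //.
  - by apply: integrable_normc => //; exact: cint_sub.
  - by have := integrableD mI01 dr' di'; apply: eq_integrable.
  move=> t _; rewrite -[r t]/(complex.Re (g t)) -[s t]/(complex.Im (g t)).
  by rewrite reB imB; exact: normc_le_ReIm.
have := ler_norm (\int[mu]_(t in I01) `|complex.Re (f n t) - r t|).
have := ler_norm (\int[mu]_(t in I01) `|complex.Im (f n t) - s t|).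
lra.
Qed.

End L1Complete.

(** * Quasi-inverses and square roots near zero *)

Section AlgebraTheory.
Context (R : realType) (V : lmodType R[i]) (mul : V -> V -> V).
Hypothesis alg : is_algebra mul.

Lemma algMDl x y z : mul (x + y) z = mul x z + mul y z.
Proof. by have := algebra_linearl alg z 1 x y; rewrite !scale1r. Qed.

Lemma algMDr x y z : mul x (y + z) = mul x y + mul x z.
Proof. by have := algebra_linearr alg x 1 y z; rewrite !scale1r. Qed.

Lemma algM0l z : mul 0 z = 0.
Proof. by apply: (addrI (mul 0 z)); rewrite -algMDl !addr0. Qed.

Lemma algM0r z : mul z 0 = 0.
Proof. by apply: (addrI (mul z 0)); rewrite -algMDr !addr0. Qed.

Lemma algMZl (a : R[i]) x z : mul (a *: x) z = a *: mul x z.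
Proof. by have := algebra_linearl alg z a x 0; rewrite !addr0 algM0l addr0. Qed.

Lemma algMZr (a : R[i]) x z : mul z (a *: x) = a *: mul z x.
Proof. by have := algebra_linearr alg z a x 0; rewrite !addr0 algM0r addr0. Qed.

Lemma algMNl x z : mul (- x) z = - mul x z.
Proof. by rewrite -scaleN1r algMZl scaleN1r. Qed.

Lemma algMNr x z : mul z (- x) = - mul z x.
Proof. by rewrite -scaleN1r algMZr scaleN1r. Qed.

(** If L is a proper left ideal with u a right identity modulo L, and y is a
    quasi-inverse of u, then u = yu - y is in L, so every x = (x - xu) + xu is in
    L. Thus there is no maximal modular left ideal at all. *)
Lemma radical_of_quasi_regular :
  (forall u, quasi_regular mul u) -> radical_algebra mul.
Proof.
move=> qr; apply/seteqP; split => // x _ L [[L0 Llin Lmul] [u Lu] LT _].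
exfalso; apply: LT; apply/seteqP; split => // z _.
have [y [_ yu]] := qr u.
have LN w : L w -> L (- w).
  by move=> Lw; have := Llin (- 1) w 0 Lw L0; rewrite addr0 scaleN1r.
have LD w w' : L w -> L w' -> L (w + w').
  by move=> Lw Lw'; have := Llin 1 w w' Lw Lw'; rewrite scale1r.
have Luu : L u.
  have -> : u = - (y - mul y u).
    by apply/eqP; rewrite -addr_eq0 addrA yu.
  exact: LN.
by rewrite -(subrK (mul z u) z); apply: LD => //; exact: Lmul.
Qed.

End AlgebraTheory.

Section BanachStarTheory.
Context (R : realType) (V : normedModType R[i]).
Variables (mul : V -> V -> V) (star : V -> V).
Hypotheses (bsa : is_banach_star_algebra mul star) (mulC : commutative mul).

Let alg := banach_algebra bsa.

Lemma rnormM x y : rnorm (mul x y) <= rnorm x * rnorm y.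
Proof. by have := banach_norm_mul bsa x y; rewrite !rnormE -rmorphM lecR. Qed.

Lemma rnorm_star x : rnorm (star x) = rnorm x.
Proof. by rewrite /rnorm (banach_norm_star bsa). Qed.

Lemma starD x y : star (x + y) = star x + star y.
Proof.
have := involution_semilinear (banach_involution bsa) 1 x y.
by rewrite rmorph1 !scale1r.
Qed.

Lemma star0 : star 0 = 0.
Proof. by apply: (addrI (star 0)); rewrite -starD !addr0. Qed.

Lemma starZ (a : R[i]) x : star (a *: x) = a^* *: star x.
Proof.
by have := involution_semilinear (banach_involution bsa) a x 0; rewrite star0 !addr0.
Qed.

Lemma starN x : star (- x) = - star x.
Proof. by rewrite -scaleN1r starZ rmorphN rmorph1 scaleN1r. Qed.

(** y is the fixed point of the contraction y |-> uy - u. *)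
Lemma quasi_inverse_small u : rnorm u <= 2^-1 ->
  exists y, u + y - mul u y = 0.
Proof.
move=> u2.
have [||||y _ yE] := half_contraction_fixpoint (banach_complete bsa)
    (P := fun=> True) (F := fun y => mul u y - u) (x0 := 0) => //.
  move=> x y _ _; rewrite opprD addrACA subrr addr0 -(algMNr alg) -(algMDr alg).
  by apply: le_trans (rnormM _ _) _; rewrite ler_wpM2r// rnorm_ge0.
by exists y; rewrite -{1}yE addrCA subrr addr0 subrr.
Qed.

(** In the unitization the conclusion says that e - h = (e - y)^2. The map
    y |-> (h + y^2)/2 preserves the closed ball of radius 1/2 and has ratio 1/2
    there, as x^2 - y^2 = (x + y)(x - y). Hermitian elements form a closed set,
    so the fixed point is hermitian. *)
Lemma quasi_sqrt_small h : star h = h -> rnorm h <= 2^-1 ->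
  exists2 y, star y = y & y + y - mul y y = h.
Proof.
move=> hh h2.
have half : Normc.normc (2^-1 : R[i]) = 2^-1.
  have -> : 2^-1 = (2^-1)%:C :> R[i] by rewrite fmorphV rmorph_nat.
  by rewrite /= expr0n addr0 sqrtr_sqr ger0_norm// invr_ge0.
have halfJ : (2^-1 : R[i])^* = 2^-1 by rewrite fmorphV rmorph_nat.
have starH y : star (2^-1 *: y) = 2^-1 *: star y.
  by rewrite starZ; congr (_ *: _); exact: halfJ.
have [||||y [yy _] yE] := half_contraction_fixpoint (banach_complete bsa)
    (P := fun y => star y = y /\ rnorm y <= 2^-1)
    (F := fun y => 2^-1 *: (h + mul y y)) (x0 := 0).
- by rewrite star0 rnorm0 invr_ge0.
- move=> y [yy y2]; split.
    by rewrite starH starD hh (involution_mul (banach_involution bsa)) yy.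
  rewrite rnormZ half; have := rnormD h (mul y y); have := rnormM y y.
  have : rnorm y * rnorm y <= 2^-1 * 2^-1 by rewrite ler_pM// rnorm_ge0.
  lra.
- move=> u l Pu ul; split.
    apply/eqP; rewrite -subr_eq0; apply/eqP/rnorm_eq0.
    apply/le_anti; rewrite rnorm_ge0 andbT; apply/ler_addgt0Pl => e e0; rewrite addr0.
    have [N h'] := ul _ (divr_gt0 e0 (ltr0n R 2)); have uN := h' N (leqnn _).
    have [uu _] := Pu N.
    have := rnorm_triangle (u N) (star l) l.
    rewrite -{1}uu -starN -starD rnorm_star (rnormBC l); lra.
  apply/ler_addgt0Pl => e e0.
  have [N h'] := ul _ e0; have uN := h' N (leqnn _); have [_ uu] := Pu N.
  by have := rnormD (l - u N) (u N); rewrite subrK (rnormBC l); lra.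
- move=> x y [_ x2] [_ y2].
  rewrite -scalerBr rnormZ half ler_wpM2l ?invr_ge0//.
  have -> : h + mul x x - (h + mul y y) = mul (x + y) (x - y).
    rewrite (algMDl alg) !(algMDr alg) !(algMNr alg) (mulC y x).
    by rewrite addrA subrK opprD addrACA subrr add0r.
  apply: le_trans (rnormM _ _) _; rewrite -[leRHS]mul1r ler_wpM2r ?rnorm_ge0//.
  have := rnormD x y; lra.
exists y => //.
have y2 : h + mul y y = y + y.
  by rewrite -{3 4}yE -scalerDl -[_ + _ in LHS]scale1r; congr (_ *: _); field.
by rewrite -y2 addrK.
Qed.

End BanachStarTheory.

(** * Adjunction of an identity *)

Section UnitizationTheory.
Context (R : realType) (V : normedModType R[i]).
Variables (mul : V -> V -> V) (star : V -> V).
Hypotheses (bsa : is_banach_star_algebra mul star) (mulC : commutative mul).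

Local Notation A := (unitization V).
Local Notation mulA := (unit_mul mul).
Local Notation starA := (unit_star star).
Let e : A := unit_one V.
Let alg := banach_algebra bsa.

Lemma unitP (x y : A) : x.1 = y.1 -> x.2 = y.2 -> x = y.
Proof. by case: x y => ? ? [? ?] /= -> ->. Qed.

Lemma unit_mulC : commutative mulA.
Proof.
move=> x y; apply: unitP => /=; last exact: mulrC.
by rewrite mulC addrAC.
Qed.

Lemma unit_mulA : associative mulA.
Proof.
move=> x y z; apply: unitP => /=; last exact: mulrA.
rewrite !(algMDl alg) !(algMDr alg) !(algMZl alg) !(algMZr alg) !scalerDr !scalerA.
rewrite (algebra_mulA alg) (mulrC z.2 y.2) (mulrC z.2 x.2).
rewrite !addrA.
by rewrite [RHS](ACl (1*4*2*5*3*6*7)).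
Qed.

Lemma unit_mul1l : left_id e mulA.
Proof.
move=> x; apply: unitP => /=; last exact: mul1r.
by rewrite (algM0l alg) add0r scaler0 add0r scale1r.
Qed.

Lemma unit_identity : is_identity mulA e.
Proof. by split; [exact: unit_mul1l|move=> x; rewrite unit_mulC unit_mul1l]. Qed.

Lemma unit_mul_linearl y : linear (mulA^~ y).
Proof.
move=> a x z; apply: unitP => /=.
  rewrite (algMDl alg) (algMZl alg) !scalerDr !scalerDl !scalerA (mulrC y.2 a).
  by rewrite !addrA [RHS](ACl (1*4*2*5*3*6)).
by rewrite mulrDl -mulrA.
Qed.

Lemma unit_is_algebra : is_algebra mulA.
Proof.
split; [exact: unit_mulA|exact: unit_mul_linearl|].
by move=> x a y z; rewrite unit_mulC unit_mul_linearl !(unit_mulC x).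
Qed.

Lemma unit_is_involution : is_involution mulA starA.
Proof.
have inv := banach_involution bsa.
split.
- move=> a x y; apply: unitP => /=; first exact: involution_semilinear inv _ _ _.
  by rewrite rmorphD rmorphM.
- move=> x y; apply: unitP => /=; last by rewrite rmorphM mulrC.
  rewrite !(starD bsa) !(starZ bsa) (involution_mul inv).
  by rewrite addrAC.
- by move=> x; apply: unitP => /=; [exact: involution_invol inv _|exact: conjcK].
Qed.

Lemma unit_normM (x y : A) : `|mulA x y| <= `|x| * `|y|.
Proof.
rewrite !unitization_normE/= mulrDl !mulrDr normrM.
apply: (@le_trans _ _ (`|x.1| * `|y.1| + `|y.2 : R[i]| * `|x.1| + `|x.2 : R[i]| * `|y.1| +
   `|x.2 : R[i]| * `|y.2 : R[i]|)).
  rewrite lerD2r; apply: le_trans (ler_normD _ _) _; apply: lerD.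
    apply: le_trans (ler_normD _ _) _; apply: lerD; last by rewrite normrZ.
    exact: banach_norm_mul bsa _ _.
  by rewrite normrZ.
by rewrite (mulrC _ `|x.1|) !addrA.
Qed.

Lemma rnorm_unitE (x : A) : rnorm x = rnorm x.1 + Normc.normc (x.2 : R[i]).
Proof. by rewrite /rnorm unitization_normE rnormE. Qed.

Lemma unit_norm_star (x : A) : `|starA x| = `|x|.
Proof.
by rewrite !unitization_normE/= (banach_norm_star bsa); congr (_ + _); exact: norm_conjC.
Qed.

Lemma rnorm_unit1 : rnorm e = 1.
Proof. by rewrite rnorm_unitE/= rnorm0 add0r expr1n expr0n addr0 sqrtr1. Qed.

(** A functional phi of norm at most 1 with phi w = 1 and |w| = 1 makes the line
    C w an isometric copy of C that phi retracts. So the completeness of V also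
    provides the limits of the scalar components. *)
Lemma unit_complete : (exists2 w : V, rnorm w = 1 & exists2 phi : V -> R[i],
    (forall a x y, phi (a *: x + y) = a * phi x + phi y) /\
    (forall x, Normc.normc (phi x) <= rnorm x) & phi w = 1) ->
  filter_complete A.
Proof.
move=> [w w1 [phi [philin phile] phiw]].
apply: fast_filter_complete => u du.
have h2 n : (0 : R) < 2^-1 ^+ n by rewrite exprn_gt0// invr_gt0.
have cau (v : nat -> V) : (forall n, rnorm (v n.+1 - v n) <= 2^-1 ^+ n) ->
    exists l, seq_cvg v l.
  move=> dv; apply: (seq_cauchy_cvg (banach_complete bsa)).
  by apply: (geometric_seq_cauchy ler01) => n; rewrite mul1r.
have du1 n : rnorm ((u n.+1).1 - (u n).1) <= 2^-1 ^+ n.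
  by apply: le_trans (du n); rewrite rnorm_unitE/= lerDl normc_ge0.
have du2 n : rnorm ((u n.+1).2 *: w - (u n).2 *: w) <= 2^-1 ^+ n.
  apply: le_trans (du n); rewrite rnorm_unitE/= -scalerBl rnormZ w1 mulr1.
  by rewrite lerDr rnorm_ge0.
have [l1 ul1] := cau _ du1; have [l2 ul2] := cau _ du2.
exists ((l1, phi l2) : A) => eps eps0.
have e2 : 0 < eps / 2 by rewrite divr_gt0.
have [N1 h1] := ul1 _ e2; have [N2 h3] := ul2 _ e2.
exists (maxn N1 N2) => n; rewrite geq_max => /andP[n1 n2].
rewrite rnorm_unitE/=.
have := phile ((u n).2 *: w - l2).
have -> : phi ((u n).2 *: w - l2) = (u n).2 - phi l2.
  have phi0 : phi 0 = 0.
    by have := philin (- 1) 0 0; rewrite scaler0 addr0 mulN1r addNr.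
  have := philin (u n).2 w 0; rewrite !addr0 phi0 phiw mulr1 addr0 => phiu.
  by rewrite addrC -scaleN1r philin phiu mulN1r addrC.
have := h1 n n1; have := h3 n n2; lra.
Qed.

Lemma unit_banach : filter_complete A -> is_banach_star_algebra mulA starA.
Proof.
move=> cA; split => //; [exact: unit_is_algebra|exact: unit_is_involution|
  exact: unit_normM|exact: unit_norm_star].
Qed.

Hypothesis qr : forall u, quasi_regular mul u.

(** f + a e = a (e - g) with g = - f / a, and a quasi-inverse of g gives an inverse
    of e - g. *)
Lemma unit_invertible (x : A) : x.2 != 0 -> invertible mulA e x.
Proof.
case: x => f a /= a0; have [y [yE _]] := qr (- a^-1 *: f).
suff xy : mulA (f, a) ((- a^-1 *: y, a^-1) : A) = e.
  by exists (- a^-1 *: y, a^-1); split => //; rewrite unit_mulC.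
apply: unitP => /=; last by rewrite divff.
rewrite (algMZr alg) scalerA mulrN divff// scaleN1r scaleNr.
move: yE; rewrite (algMZl alg) !scaleNr opprK => yE.
by apply/eqP; rewrite -oppr_eq0 !opprD !opprK (ACl (2*3*1)) /= yE.
Qed.

(** The scalar component of e + x^* x is 1 + |a|^2, which is not zero. *)
Lemma unit_symmetric : symmetric_unital mulA starA e.
Proof.
move=> x; apply: unit_invertible => /=.
have : 0 < 1 + (x.2 : R[i])^* * x.2 by rewrite ltr_pwDl// mulrC mul_conjC_ge0.
by move=> /gt_eqF ->.
Qed.

(** All the elements outside of V are invertible, so every proper left ideal is
    contained in V, which is therefore the only maximal left ideal. *)
Lemma unit_radical : radical mulA = range (@unit_inj R V).
Proof.
have rangeE (x : A) : range (@unit_inj R V) x <-> x.2 = 0.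
  split=> [[f _ <-]//|x0]; exists x.1 => //; exact: unitP.
have Eideal : left_ideal mulA (range (@unit_inj R V)).
  split.
  - by apply/rangeE.
  - by move=> a x y /rangeE x0 /rangeE y0; apply/rangeE; rewrite /= x0 y0 addr0 scaler0.
  - by move=> a x /rangeE x0; apply/rangeE; rewrite /= x0 mulr0.
have eE : ~ range (@unit_inj R V) e.
  by move/rangeE => /= /eqP; rewrite oner_eq0.
have ET : range (@unit_inj R V) <> setT by move=> ET; apply: eE; rewrite ET.
have big (M : set A) x : left_ideal mulA M -> M x -> x.2 != 0 -> M = setT.
  move=> [_ _ Mmul] Mx x0; have [y [_ yx]] := unit_invertible x0.
  have Me : M e by rewrite -yx; exact: Mmul.
  apply/seteqP; split => // z _.
  by rewrite -(unit_identity.2 z); exact: Mmul.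
apply/seteqP; split.
  move=> x; apply; split => //.
    exists e => z; rewrite (unit_identity.2 z) subrr; exact: left_ideal0 Eideal.
  move=> M idM EM; have [[z [Mz z0]]|nM] := pselect (exists z, M z /\ z.2 != 0).
    by right; exact: big Mz z0.
  left; apply/seteqP; split => // z Mz; apply/rangeE/eqP.
  by apply: contrapT => /negP z0; apply: nM; exists z.
move=> x Ex L [idL _ LT Lmax].
have LE : L `<=` range (@unit_inj R V).
  move=> z Lz; apply/rangeE/eqP; apply: contrapT => /negP z0.
  by apply: LT; exact: big Lz z0.
by case: (Lmax _ Eideal LE) => // <-.
Qed.

(** For h hermitian and t real, e - t h is the square of a hermitian element, so
    F e - t F h >= 0. This holds for all real t only if F h = 0; and the
    hermitian elements span V. *)
Lemma positive_vanish (F : A -> R[i]^o) :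
  (forall h, star h = h -> exists2 y, star y = y & y + y - mul y y = h) ->
  positive_functionals mulA starA F -> forall h, F (unit_inj h) = 0.
Proof.
move=> sq [Flin Fpos].
have FZ a x : F (a *: x) = a * F x.
  have F0 : F 0 = 0.
    by have := Flin (- 1) 0 0; rewrite scaler0 addr0 scaleN1r addNr.
  by have := Flin a x 0; rewrite !addr0 F0 addr0.
have FD x y : F (x + y) = F x + F y by have := Flin 1 x y; rewrite !scale1r.
have sa (h : V) : star h = h -> forall t : R, 0 <= (F e - t%:C * F (unit_inj h) : R[i]).
  move=> hh t; have [|y yy yE] := sq (t%:C *: h).
    rewrite (starZ bsa) hh; congr (_ *: _).
    by apply/eqP; rewrite eq_complex/= oppr0 !eqxx.
  (* the value at (e - y)^* (e - y) = (e - y)^2 = e - t h *)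
  have := Fpos ((- y, 1) : A).
  congr (0 <= _); rewrite -mulNr -FZ -FD; congr F; apply: unitP => /=.
    rewrite (starN bsa) yy (algMNl alg) (algMNr alg) opprK add0r scaleNr -yE.
    rewrite oppr0 -[1 +i* 0]/(1 : R[i]) !scale1r !opprD opprK.
    by rewrite [LHS](ACl (2*3*1)).
  by rewrite oppr0 -[1 +i* 0]/(1 : R[i]) mulr1 ?scaler0 ?mulr0 addr0.
have herm (h : V) : star h = h -> F (unit_inj h) = 0.
  move=> hh; have H := sa h hh; move: H.
  case: (F e) (F (unit_inj h)) => a b [c d] H.
  have Hc t : b - t * d = 0 /\ 0 <= a - t * c.
    have := H t; rewrite lecE/= => /andP[/eqP h1 h2].
    split; lra.
  have [h0 _] := Hc 0; have [h1 _] := Hc 1.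
  have d0 : d = 0 by lra.
  have c0 : c = 0.
    apply/eqP; apply: contrapT => /negP c0.
    (* t is chosen so that a - t c = -1 *)
    have [_] := Hc ((a + 1) / c); rewrite divfK//; lra.
  by rewrite c0 d0.
move=> h.
have invol := involution_invol (banach_involution bsa).
pose k := h - star h.
have sumE : F (unit_inj (h + star h)) + F (unit_inj k) = 2 * F (unit_inj h).
  rewrite -FD mulr_natl mulr2n -FD; congr F; apply: unitP => //=.
  by rewrite /k addrACA subrr addr0.
have h1 : F (unit_inj (h + star h)) = 0.
  by apply: herm; rewrite (starD bsa) invol addrC.
have h2 : 'i%C * F (unit_inj k) = 0.
  rewrite -FZ.
  have -> : 'i%C *: unit_inj k = unit_inj ('i%C *: k).
    by apply: unitP => //=; exact: mulr0.
  have starI x : star ('i%C *: x) = 'i%C *: - star x.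
    rewrite (starZ bsa) scalerN -scaleNr; congr (_ *: _).
    by apply/eqP; rewrite eq_complex/= oppr0 !eqxx.
  by apply: herm; rewrite starI /k (starD bsa) (starN bsa) invol opprD opprK addrC.
have k0 : F (unit_inj k) = 0.
  move/eqP: h2; rewrite mulf_eq0 => /orP[|/eqP//].
  by rewrite eq_complex/= oner_eq0 andbF.
move/eqP: sumE; rewrite h1 k0 addr0 eq_sym mulf_eq0 => /orP[|/eqP//].
by rewrite pnatr_eq0.
Qed.

End UnitizationTheory.

(** * Banach algebras as algebras of bounded disks *)

Section NormedSequences.
Context (R : realType).

Lemma lipschitz_continuous (V W : normedModType R[i]) (f : V -> W) (k : R) :
  0 <= k -> (forall x y, rnorm (f x - f y) <= k * rnorm (x - y)) -> continuous f.
Proof.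
move=> k0 fk x; apply/cvgrPdist_lt => eps /pos_complex[r r0 ->].
have d0 : 0 < r / (k + 1) by rewrite divr_gt0//; lra.
have : nbhs x (ball x ((r / (k + 1))%:C : R[i])) by apply: nbhsx_ballx; rewrite ltcR.
apply: filterS => y; rewrite -ball_normE /ball_/= !rnormE !ltcR => xy.
apply: le_lt_trans (fk _ _) _; have := rnorm_ge0 (x - y).
by move: xy; rewrite ltr_pdivlMr; [nra|lra].
Qed.

Lemma closed_seq_cvg (V : normedModType R[i]) (B : set V) (w : nat -> V) x :
  closed B -> (forall n, B (w n)) -> seq_cvg w x -> B x.
Proof.
move=> cB Bw wx; apply: cB => U /nbhs_ballP[eps /= /pos_complex[r r0 ->] xU].
have [N h] := wx _ r0; exists (w N); split => //; apply: xU.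
by rewrite -ball_normE /ball_/= rnormE ltcR rnormBC h.
Qed.

End NormedSequences.

(* the unqualified name is that of the Minkowski inequality for Lnorm *)
Local Notation minkowski := Defs.minkowski.

Section BanachToBP.
Context (R : realType) (V : normedModType R[i]).

(** Absorption by the open unit ball. *)
Lemma tvs_bounded_norm (B : set V) : tvs_bounded B ->
  exists2 M : R, 0 < M & forall b, B b -> rnorm b <= M.
Proof.
move=> bB; have [|r /pos_complex[s s0 ->] h] := bB (ball 0 1).
  exact: nbhsx_ballx.
exists s => // b Bb; have [|u u1 <-] := h s%:C _ b Bb.
  by rewrite ger0_norm// lecR ltW.
rewrite rnormZ normcR (ger0_norm (ltW s0)) ler_piMr ?(ltW s0)//.
by move: u1; rewrite -ball_normE /ball_/= sub0r normrN rnormE -[1]/(1%:C) ltcR => /ltW.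
Qed.

Section Disk.
Variable B : set V.
Hypotheses (conv : absolutely_convex B) (e : V) (Be : B e).

Lemma disk_scale (a : R[i]) x : Normc.normc a <= 1 -> B x -> B (a *: x).
Proof.
move=> a1 Bx; rewrite -[a *: x]addr0 -(scale0r x); apply: conv => //.
by rewrite normr0 addr0 [leLHS]/((Normc.normc a)%:C) -[1]/(1%:C) lecR.
Qed.

(** An absolutely convex set spans the union of its positive multiples. *)
Lemma lin_span_disk x : lin_span B x ->
  exists2 r : R, 0 < r & exists2 b, B b & x = r%:C *: b.
Proof.
move=> [n [c [v [Bv ->]]]].
apply: (big_ind (fun x => exists2 r : R, 0 < r & exists2 b, B b & x = r%:C *: b))
  => [|y z [r r0 [b Bb ->]] [s s0 [b' Bb' ->]]|i _].
- exists 1 => //; exists (0 *: e); last by rewrite scale0r scaler0.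
  by apply: disk_scale => //; rewrite normcR normr0.
- have rs : 0 < r + s by exact: addr_gt0.
  exists (r + s) => //.
  exists ((r / (r + s))%:C *: b + (s / (r + s))%:C *: b').
    apply: conv => //.
    have rs1 : 0 <= r / (r + s) by rewrite divr_ge0// ltW.
    have rs2 : 0 <= s / (r + s) by rewrite divr_ge0// ltW.
    by rewrite !ger0_norm ?lecR// -rmorphD/= -mulrDl divff ?gt_eqF.
  rewrite scalerDr !scalerA -!rmorphM/=.
  by congr (_%:C *: _ + _%:C *: _); field; rewrite gt_eqF.
- have r0 : 0 < Normc.normc (c i) + 1 by rewrite ltr_wpDl// normc_ge0.
  exists (Normc.normc (c i) + 1) => //.
  exists (((Normc.normc (c i) + 1)^-1%:C * c i) *: v i).
    apply: disk_scale => //; rewrite Normc.normcM normcR ger0_norm ?invr_ge0 ?(ltW r0)//.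
    by rewrite mulrC ltW// ltr_pdivrMr// mul1r ltrDl.
  by rewrite scalerA mulrA -rmorphM/= divff ?gt_eqF// mul1r.
Qed.

Lemma disk_lin_span (r : R) b : B b -> lin_span B (r%:C *: b).
Proof.
move=> Bb; exists 1%N, (fun=> r%:C), (fun=> b); split => //.
by rewrite big_ord1.
Qed.

Lemma lin_spanB x y : lin_span B x -> lin_span B y -> lin_span B (x - y).
Proof.
move=> [n [c [v [Bv ->]]]] [m [d [w [Bw ->]]]].
exists (n + m)%N,
  (fun i => match fintype.split i with inl j => c j | inr j => - d j end),
  (fun i => match fintype.split i with inl j => v j | inr j => w j end).
split=> [i|]; first by case: fintype.split.
rewrite big_split_ord/=; congr (_ + _).
  apply: eq_bigr => i _; case: splitP => [j /= /val_inj <-//|j /= E].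
  by have := ltn_ord i; rewrite E ltnNge leq_addr.
rewrite -sumrN; apply: eq_bigr => i _; rewrite -scaleNr.
case: splitP => [j /= E|j /= /addnI/val_inj <-//].
by have := ltn_ord j; rewrite -E ltnNge leq_addr.
Qed.

Lemma minkowski_ge0 x : 0 <= minkowski B x.
Proof.
rewrite /minkowski; set E := [set r | _].
have [->|/set0P E0] := eqVneq E set0; first by rewrite inf0.
by apply: lb_le_inf => // r [/ltW].
Qed.

Lemma minkowski_le (r : R) b : 0 < r -> B b -> minkowski B (r%:C *: b) <= r.
Proof.
move=> r0 Bb; apply: ge_inf; last by split => //; exists b.
by exists 0 => s [/ltW].
Qed.

Lemma minkowski_lt (r : R) x : lin_span B x -> minkowski B x < r ->
  exists2 b, B b & x = r%:C *: b.
Proof.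
move=> /lin_span_disk[s s0 sx] /inf_lt[|t [t0 [b Bb ->]] tr].
  by exists s.
exists ((t / r)%:C *: b).
  apply: disk_scale => //; rewrite normcR ger0_norm.
    by rewrite ler_pdivrMr ?mul1r ?ltW//; lra.
  by rewrite divr_ge0// ltW//; lra.
rewrite scalerA -rmorphM/= mulrC divfK// gt_eqF//; lra.
Qed.

End Disk.

Variables (mul : V -> V -> V) (star : V -> V) (e : V).
Hypotheses (bsa : is_banach_star_algebra mul star) (mulC : commutative mul).
Hypotheses (ide : is_identity mul e) (e1 : `|e| = 1).

Let alg := banach_algebra bsa.

(** A Cauchy sequence for the Minkowski norm of B is Cauchy for the norm since B is
    bounded, hence has a limit l in norm. For n large, all u n - u m lie in
    eps B; letting m tend to infinity, so does u n - l because B is closed. *)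
Lemma bp_disk_complete B : bp_disk mul star e B -> disk_complete B.
Proof.
move=> [cB bB conv _ _ Be] u Su cu.
have [M M0 BM] := tvs_bounded_norm bB.
have cau : seq_cauchy u.
  move=> eps eps0; have d0 : 0 < eps / (M + 1) by rewrite divr_gt0//; lra.
  have [N h] := cu _ d0; exists N => m n Nm Nn.
  have [b Bb ->] := minkowski_lt conv Be (lin_spanB (Su m) (Su n)) (h m n Nm Nn).
  rewrite rnormZ normcR (ger0_norm (ltW d0)).
  have := BM _ Bb; rewrite mulrAC ltr_pdivrMr; last lra.
  nra.
have [l ul] := seq_cauchy_cvg (banach_complete bsa) cau.
have close (eps : R) : 0 < eps -> exists N, forall n, (N <= n)%N ->
    exists2 b, B b & u n - l = eps%:C *: b.
  move=> eps0; have [N h] := cu _ eps0; exists N => n Nn.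
  have epsK : eps%:C * eps^-1%:C = 1 :> R[i] by rewrite -rmorphM/= divff ?gt_eqF.
  exists (eps^-1%:C *: (u n - l)); last by rewrite scalerA epsK scale1r.
  apply: (@closed_seq_cvg _ _ B (fun k => eps^-1%:C *: (u n - u (N + k)%N))) => //.
    move=> k; have Nk : (N <= N + k)%N by exact: leq_addr.
    have [b Bb ->] := minkowski_lt conv Be (lin_spanB (Su n) (Su (N + k)%N)) (h _ _ Nn Nk).
    by rewrite scalerA mulrC epsK scale1r.
  move=> d d0; have [|K hK] := ul (eps * d); first by rewrite mulr_gt0.
  exists K => k Kk; rewrite -scalerBr rnormZ normcR ger0_norm ?invr_ge0 ?(ltW eps0)//.
  have -> : u n - u (N + k)%N - (u n - l) = l - u (N + k)%N.
    by rewrite opprB addrC addrA subrK.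
  by rewrite rnormBC ltr_pdivrMl// hK// (leq_trans Kk)// leq_addl.
exists l.
  have [N h] := close 1 ltr01; have [b Bb E] := h N (leqnn _).
  by rewrite -[l](subKr (u N)) E; apply: lin_spanB => //; exact: disk_lin_span.
apply/cvgrPdist_lt => eps eps0.
have e2 : 0 < eps / 2 by rewrite divr_gt0.
have [N h] := close _ e2; exists N => // n /h[b Bb ->].
rewrite sub0r normrN ger0_norm ?minkowski_ge0//.
by have := minkowski_le e2 Bb; lra.
Qed.

Lemma bp_disk_unit_ball : bp_disk mul star e [set x | rnorm x <= 1].
Proof.
have inv := banach_involution bsa.
split => /=.
- move=> x clx; apply/ler_addgt0Pl => eps eps0.
  have [|y [/= y1]] := clx (ball x (eps%:C : R[i])).
    by apply: nbhsx_ballx; rewrite ltcR.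
  rewrite -ball_normE /ball_/= rnormE ltcR => xy.
  by have := rnormD (x - y) y; rewrite subrK; lra.
- move=> U /nbhs_ballP[eps /= /pos_complex[r r0 ->] rU].
  exists (2 / r)%:C; first by rewrite ltcR divr_gt0.
  move=> a; rewrite [`|a|]/((Normc.normc a)%:C) lecR => ra x /= x1.
  have a0 : 0 < Normc.normc a by apply: lt_le_trans ra; rewrite divr_gt0.
  have aN0 : a != 0 by apply: contra_ltN a0 => /eqP ->; rewrite normcR normr0.
  exists (a^-1 *: x); last by rewrite scalerA divff// scale1r.
  apply: rU; rewrite -ball_normE /ball_/= sub0r normrN rnormE ltcR rnormZ.
  have -> : Normc.normc a^-1 = (Normc.normc a)^-1.
    by apply: complexI; rewrite fmorphV; exact: (normfV a).
  rewrite mulrC ltr_pdivrMr//; apply: le_lt_trans x1 _.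
  move: ra; rewrite ler_pdivrMr//; lra.
- move=> a b x y ab x1 y1.
  have {}ab : Normc.normc a + Normc.normc b <= 1 by rewrite -lecR rmorphD; exact: ab.
  have := rnormD (a *: x) (b *: y); rewrite !rnormZ.
  have : Normc.normc a * rnorm x <= Normc.normc a by rewrite ler_piMr ?normc_ge0.
  have : Normc.normc b * rnorm y <= Normc.normc b by rewrite ler_piMr ?normc_ge0.
  rewrite /=; lra.
- apply/seteqP; split => [_ [x /= x1 <-]|x /= x1]; first by rewrite (rnorm_star bsa).
  exists (star x); first by rewrite /= (rnorm_star bsa).
  exact: involution_invol inv _.
- move=> x y x1 y1; apply: le_trans (rnormM bsa _ _) _.
  by rewrite mulr_ile1// rnorm_ge0.
- by rewrite /rnorm e1.
Qed.

(** The closed unit ball belongs to the family of disks and spans everything. *)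
Lemma banach_is_BPstar : is_BPstar_algebra mul star e.
Proof.
have contM x : continuous (mul x).
  apply: (lipschitz_continuous (rnorm_ge0 x)) => y z.
  by rewrite -(algMNr alg) -(algMDr alg); exact: (rnormM bsa).
split => //.
- split; [exact: alg|exact: norm_hausdorff| |exact: contM].
  move=> y; rewrite (_ : mul^~ y = mul y); [exact: contM|apply/funext => x; exact: mulC].
- exact: banach_involution bsa.
- apply: (lipschitz_continuous ler01) => x y.
  by rewrite mul1r -(starN bsa) -(starD bsa) (rnorm_star bsa).
- apply/esym/seteqP; split => // x _.
  exists [set x | rnorm x <= 1]; first exact: bp_disk_unit_ball.
  have r0 : 0 < rnorm x + 1 by rewrite ltr_wpDl// rnorm_ge0.
  have -> : x = (rnorm x + 1)%:C *: ((rnorm x + 1)^-1%:C *: x).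
    by rewrite scalerA -rmorphM/= divff ?gt_eqF// scale1r.
  apply: disk_lin_span => /=; rewrite rnormZ normcR ger0_norm ?invr_ge0 ?(ltW r0)//.
  by rewrite mulrC ler_pdivrMr// mul1r lerDl.
- exact: bp_disk_complete.
Qed.

End BanachToBP.

(** * The counterexample *)

Section L1Final.
Context (R : realType).
Local Notation E := (L1 R).

Lemma L1_banach_star : is_banach_star_algebra (@l1_mul R) (@l1_star R).
Proof.
split.
- split; [exact: l1_mulA|exact: l1_mul_linearl|exact: l1_mul_linearr].
- split; [exact: l1_star_semilinear|exact: l1_starM|exact: l1_starK].
- exact: l1_normM.
- exact: l1_norm_star.
- exact: L1_complete.
Qed.

Lemma l1_dilation_small (u : E) : exists n : nat, rnorm (l1_dilation (- n%:R) u) <= 2^-1.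
Proof.
have h : (0 : R) < 2^-1 by rewrite invr_gt0.
have := l1_dilation_norm_cvg u => /cvgrPdist_lt/(_ _ h)[N _ H].
exists N; have := H N (leqnn N); rewrite /= sub0r normrN => /ltW.
by apply: le_trans; exact: ler_norm.
Qed.

Lemma l1_dilationD l (u v : E) : l1_dilation l (u + v) = l1_dilation l u + l1_dilation l v.
Proof. by have := l1_dilation_linear l 1 u v; rewrite !scale1r. Qed.

Lemma l1_dilation0 l : l1_dilation l (0 : E) = 0.
Proof. by apply: (addrI (l1_dilation l 0)); rewrite -l1_dilationD !addr0. Qed.

Lemma l1_dilationN l (u : E) : l1_dilation l (- u) = - l1_dilation l u.
Proof. by apply/eqP; rewrite -addr_eq0 -l1_dilationD addNr l1_dilation0. Qed.

(** A dilation with small enough exponent moves u into the ball where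
    quasi-inverses exist; the opposite dilation moves the quasi-inverse back. *)
Lemma l1_quasi_regular (u : E) : quasi_regular (@l1_mul R) u.
Proof.
have [n /(quasi_inverse_small L1_banach_star)[y yE]] := l1_dilation_small u.
suff H : u + l1_dilation n%:R y - l1_mul u (l1_dilation n%:R y) = 0.
  by exists (l1_dilation n%:R y); rewrite (l1_mulC _ u).
rewrite -[u](l1_dilationK n%:R) -l1_dilationM -l1_dilationN -!l1_dilationD.
by rewrite yE l1_dilation0.
Qed.

(** Dilations with real exponent preserve hermitian elements, hence small h
    suffices, as for quasi-inverses. *)
Lemma l1_quasi_sqrt (h : E) : l1_star h = h ->
  exists2 y, l1_star y = y & y + y - l1_mul y y = h.
Proof.
move=> hh; have [n small] := l1_dilation_small h.
have [|y yy yE] := quasi_sqrt_small L1_banach_star (@l1_mulC R) _ small.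
  by rewrite -l1_dilation_star hh.
exists (l1_dilation n%:R y); first by rewrite -l1_dilation_star yy.
by rewrite -l1_dilationM -l1_dilationN -!l1_dilationD yE l1_dilationK.
Qed.

Lemma rnorm_one : rnorm (l1_class (fun=> 1) : E) = 1.
Proof. by rewrite /rnorm l1_norm_cst normr1. Qed.

Lemma unit_L1_complete : filter_complete (unitization E).
Proof.
apply: (unit_complete L1_banach_star).
exists (l1_class (fun=> 1)); first exact: rnorm_one.
exists (@l1_int R); last exact: l1_int_cst.
split; first exact: l1_int_lin.
by move=> x; have := normr_l1_int x; rewrite rnormE [`|l1_int x|]/((Normc.normc _)%:C) lecR.
Qed.

(** Integration of the component in E is continuous and takes the value 1 at the
    class of the constant function 1, where positive functionals vanish. *)
Lemma dual_not_in_span : ~ (topological_dual (unitization E) `<=`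
  lin_span (positive_functionals (unit_mul (@l1_mul R)) (unit_star (@l1_star R)))).
Proof.
pose phi : unitization E -> R[i]^o := fun x => l1_int x.1.
have phi_dual : topological_dual (unitization E) phi.
  split; first by move=> a x y; exact: l1_int_lin.
  apply: (lipschitz_continuous ler01) => x y; rewrite mul1r.
  have -> : phi x - phi y = l1_int (x.1 - y.1).
    by rewrite [in RHS]addrC -[in RHS]scaleN1r l1_int_lin mulN1r [RHS]addrC.
  apply: (@le_trans _ _ (rnorm (x.1 - y.1))).
    by have := normr_l1_int (x.1 - y.1); rewrite !rnormE lecR.
  by rewrite rnorm_unitE lerDl normc_ge0.
move=> /(_ _ phi_dual)[n [c [v [pv phiE]]]].
have : phi (unit_inj (l1_class (fun=> 1))) = 0.
  rewrite phiE fct_sumE big1// => i _.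
  have := positive_vanish L1_banach_star l1_quasi_sqrt (pv i).
  by move=> /(_ (l1_class (fun=> 1))) V0; rewrite /= [LHS]/(c i *: v i _) V0; exact: mulr0.
by rewrite /phi/= l1_int_cst => /eqP; rewrite oner_eq0.
Qed.

End L1Final.

Theorem mainTheorem3 (R : realType) :
  let mu := @lebesgue_measure R in
  let mulE := @l1_mul R in
  let starE := @l1_star R in
  let mulA := unit_mul mulE in
  let starA := unit_star starE in
  let e := unit_one (L1 R) in
  (* the operations of E are the ones induced by the operations on functions *)
  (forall f g : R -> R[i]^o,
     cintegrable mu `[0, 1] f -> cintegrable mu `[0, 1] g ->
     [/\ {ae mu, forall x : R, 0 <= x <= 1 ->
            cintegrable mu `[0, x] (fun t : R => f (x - t) * g t)},
         cintegrable mu `[0, 1] (convolution f g),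
         mulE (l1_class f) (l1_class g) = l1_class (convolution f g),
         cintegrable mu `[0, 1] (fun x : R => (f x)^*) &
         starE (l1_class f) = l1_class (fun x => (f x)^*)]) /\
  (* E *)
  [/\ is_banach_star_algebra mulE starE,
      commutative mulE,
      symmetric_nonunital mulE starE &
      radical_algebra mulE] /\
  (* A = E + C e *)
  [/\ is_banach_star_algebra mulA starA,
      commutative mulA,
      is_identity mulA e /\ `|e| = 1 &
      symmetric_unital mulA starA e] /\
  radical mulA = range (@unit_inj R (L1 R)) /\
  ~ semisimple mulA /\
  ~ (topological_dual (unitization (L1 R)) `<=`
       lin_span (positive_functionals mulA starA)) /\
  is_BPstar_algebra mulA starA e /\
  ~ hennings_question R.
Proof.
have bE := @L1_banach_star R; have mC := @l1_mulC R; have qr := @l1_quasi_regular R.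
have bA := unit_banach bE mC (@unit_L1_complete R).
have e1 : `|unit_one (L1 R)| = 1 by rewrite rnormE rnorm_unit1.
have idA := unit_identity bE mC.
have bp := banach_is_BPstar bA (unit_mulC mC) idA e1.
have radE := unit_radical bE mC qr.
have ns := @dual_not_in_span R.
split.
  move=> f g fi gi; split.
  - apply: filterS (ae_cintegrable_ckernel fi gi) => x k x01.
    exact/cintegrable_ckernelP.
  - exact: cint_convolution.
  - exact: l1_mul_class.
  - exact (cintegrableJ (@measurable_I01 R) fi).
  - exact: l1_star_class.
split.
  split => //; exact: (radical_of_quasi_regular qr).
split; first by split => //; [exact: unit_mulC|exact: unit_symmetric].
split => //; split.
  rewrite /semisimple radE => E0.
  have : range (@unit_inj R (L1 R)) (unit_inj (l1_class (fun=> 1))).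
    by exists (l1_class (fun=> 1)).
  rewrite E0 => -[] /(congr1 (@rnorm R (L1 R))); rewrite rnorm_one rnorm0.
  by move/eqP; rewrite oner_eq0.
split => //; split => //.
by move=> hq; apply: ns; exact: hq bp.
Qed.
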